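(* Let $D$ be a domain in $\mathbb{C}^n$ and let $f=\mathcal{I}(F)\in\mathcal{S}(\Omega_D,\mathbb{O})$ be the slice function induced by an $\mathbb{O}$-stem function $F:D\to\mathbb{O}_{\mathbb{C}}$. For $a\in\mathbb{C}^n$ and $j\in\{1,\dots,n\}$ put $$D_{j,a}=\{z_j\in\mathbb{C}:(a_1,\dots,a_{j-1},z_j,a_{j+1},\dots,a_n)\in D\},\qquad F_{j,a}(z_j)=F(a_1,\dots,a_{j-1},z_j,a_{j+1},\dots,a_n)\quad(z_j\in D_{j,a}).$$ If for every $a\in\mathbb{C}^n$ and every $j=1,\dots,n$ the lift $f_{j,a}:=\mathcal{I}(F_{j,a})$ belongs to $\mathcal{SR}(\Omega_{D_{j,a}},\mathbb{O})$ (that is, $F_{j,a}$ is an $\mathbb{O}$-stem function on $D_{j,a}\subset\mathbb{C}$ and it is holomorphic), then $f\in\mathcal{SR}(\Omega_D,\mathbb{O})$.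
   Context: $\mathbb{O}$ denotes the (nonassociative, alternative) algebra of octonions, $\mathbb{S}=\{a\in\mathbb{O}: a^2=-1\}$. For $J\in\mathbb{S}$, $\mathbb{C}_J=\mathbb{R}+J\mathbb{R}\subset\mathbb{O}$ and $\mathbb{C}_J^n=(\mathbb{C}_J)^n$; $\mathbb{O}_s^n=\bigcup_{J\in\mathbb{S}}\mathbb{C}_J^n\subset\mathbb{O}^n$. The complexification is $\mathbb{O}_{\mathbb{C}}=\mathbb{O}\otimes_{\mathbb{R}}\mathbb{C}=\{x+iy: x,y\in\mathbb{O}\}$, $i^2=-1$, with product $(x+iy)(u+iv)=xu-yv+i(xv+yu)$ and complex conjugation $\overline{x+iy}=x-iy$; its complex structure is left multiplication by $i$. For any $m\ge1$ and open $D\subset\mathbb{C}^m$: $\overline{z}$ is the componentwise conjugate and $\mathrm{conj}(D)=\{z\in\mathbb{C}^m:\overline{z}\in D\}$. A function $F=F_1+iF_2:D\to\mathbb{O}_{\mathbb{C}}$ ($F_1,F_2$ being $\mathbb{O}$-valued) is an $\mathbb{O}$-stem function if $F(\overline{z})=\overline{F(z)}$ for $z\in D$; if $D$ is not invariant under conjugation, the condition is required whenever $z,\overline{z}\in D$, and $F$ is extended to $D\cup\mathrm{conj}(D)$ by this formula. Put $\Omega_D=\{\alpha+\beta J\in\mathbb{C}_J^m: J\in\mathbb{S},\ \alpha,\beta\in\mathbb{R}^m,\ \alpha+i\beta\in D\}$. A stem function $F$ induces the (left) slice function $f=\mathcal{I}(F):\Omega_D\to\mathbb{O}$, $f(\alpha+\beta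 J)=F_1(\alpha+i\beta)+JF_2(\alpha+i\beta)$ (well defined). $\mathcal{S}(\Omega_D,\mathbb{O})$ is the set of all slice functions $\mathcal{I}(F)$, and $\mathcal{SR}(\Omega_D,\mathbb{O})$ (the slice regular functions) is the set of $\mathcal{I}(F)$ with $F$ a $C^1$ stem function that is holomorphic, i.e. $\frac{\partial F}{\partial\overline{z}_t}=\frac12\big(\frac{\partial F}{\partial\alpha_t}+i\frac{\partial F}{\partial\beta_t}\big)=0$ for all $t$, where $z_t=\alpha_t+i\beta_t$. For empty $D_{j,a}$ the hypothesis is vacuous. *)

(* Defs.v *)
From HB Require Import structures.
From mathcomp Require Import all_boot all_order all_algebra.
From mathcomp Require Import complex.
From mathcomp Require Import all_classical all_reals all_analysis.
From mathcomp Require Import ring lra.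
Import numFieldNormedType.Exports.

Set Implicit Arguments.
Unset Strict Implicit.
Unset Printing Implicit Defensive.

Import Order.TTheory GRing.Theory Num.Theory.

Local Open Scope classical_set_scope.
Local Open Scope ring_scope.
Local Open Scope complex_scope.

(* The usual topology and norm of C, so that 'rV[R[i]]_m is the topological
   space C^m. *)
HB.instance Definition _ (R : realType) := NormedModule.copy R[i] R[i]^o.

(* One Cayley-Dickson step: conj (a, b) = (conj a, - b) and
   (a, b) (c, d) = (a c - conj d * b, d a + b * conj c). *)
Definition cd_conj (A : zmodType) (conj : A -> A) (x : A * A) : A * A :=
  (conj x.1, - x.2).

Definition cd_mul (A : zmodType) (conj : A -> A) (mul : A -> A -> A)
    (x y : A * A) : A * A :=
  (mul x.1 y.1 - mul (conj y.2) x.2, mul y.2 x.1 + mul x.2 (conj y.1)).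

(* The octonions are obtained from R by three Cayley-Dickson steps. Their
   product is [omul], not the componentwise product of pairs. *)
Definition octonion (R : realType) : Type :=
  (((R * R) * (R * R)) * ((R * R) * (R * R)))%type.

Section Octonions.
Variable R : realType.

Definition omul : octonion R -> octonion R -> octonion R :=
  let conj1 : R * R -> R * R := cd_conj id in
  let mul1 : R * R -> R * R -> R * R := cd_mul id (fun x y : R => x * y) in
  cd_mul (cd_conj conj1) (cd_mul conj1 mul1).

Definition oone : octonion R := (((1, 0), (0, 0)), ((0, 0), (0, 0))).

Definition osphere : set (octonion R) := [set J | omul J J = - oone].

(* The complexified octonions: (x, y) stands for x + i y. *)
Definition octC : Type := (octonion R * octonion R)%type.

Definition ocmul (p q : octC) : octC :=
  (omul p.1 q.1 - omul p.2 q.2, omul p.1 q.2 + omul p.2 q.1).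

Definition oc_conj (p : octC) : octC := (p.1, - p.2).

Definition oc_i : octC := (0, oone).

End Octonions.

(* Functions on D are represented by total functions, of which only the values
   on D are relevant. *)
Section SliceFunctions.
Variables (R : realType) (m : nat).
Implicit Types (D : set 'rV[R[i]]_m) (F : 'rV[R[i]]_m -> octC R).
Implicit Types (z : 'rV[R[i]]_m) (J : octonion R).

Definition conj_pt z : 'rV[R[i]]_m := map_mx (@conjc R) z.

Definition is_stem D F : Prop :=
  forall z, D z -> D (conj_pt z) -> F (conj_pt z) = oc_conj (F z).

(* alpha + beta J, where z = alpha + i beta. *)
Definition slice_pt J z : 'rV[octonion R]_m :=
  \row_t (complex.Re (z 0 t) *: oone R + complex.Im (z 0 t) *: J).

Definition Omega D : set 'rV[octonion R]_m :=
  [set x | exists J z, [/\ osphere J, D z & x = slice_pt J z]].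

(* I(F), extended by 0 outside of Omega D; the value does not depend on the
   representation of the point when F is a stem function, see [slice_liftE]. *)
Definition slice_lift D F (x : 'rV[octonion R]_m) : octonion R :=
  xget 0 [set y | exists J z, [/\ osphere J, D z, x = slice_pt J z &
                                  y = (F z).1 + omul J (F z).2]].

(* The function h |-> F (z + h u e_t) of the real variable h. Its derivative at
   0 is the partial derivative of F with respect to alpha_t for u = 1, and with
   respect to beta_t for u = i. *)
Definition along F (u : R[i]) (t : 'I_m) z : R -> octC R :=
  fun h => F (z + (h%:C * u) *: delta_mx 0 t).

Definition d_alpha F (t : 'I_m) z : octC R := derive1 (along F 1 t z) 0.

Definition d_beta F (t : 'I_m) z : octC R := derive1 (along F (0 +i* 1) t z) 0.

Definition C1_on D F : Prop :=
  forall t : 'I_m,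
    [/\ forall z, D z -> derivable (along F 1 t z) 0 1,
        forall z, D z -> derivable (along F (0 +i* 1) t z) 0 1,
        {within D, continuous (d_alpha F t)} &
        {within D, continuous (d_beta F t)}].

Definition dbar F (t : 'I_m) z : octC R :=
  2^-1 *: (d_alpha F t z + ocmul (oc_i R) (d_beta F t z)).

Definition holomorphic_on D F : Prop :=
  forall (t : 'I_m) z, D z -> dbar F t z = 0.

Definition slice_regular D : set ('rV[octonion R]_m -> octonion R) :=
  [set f : 'rV[octonion R]_m -> octonion R | exists F, [/\ is_stem D F, C1_on D F, holomorphic_on D F &
                        {in Omega D, f =1 slice_lift D F}]].

End SliceFunctions.

Section OneVariable.
Variables (R : realType) (n : nat).

(* (a_1, ..., a_{j-1}, w, a_{j+1}, ..., a_n), with w in C^1. *)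
Definition subst_pt (a : 'rV[R[i]]_n) (j : 'I_n) (w : 'rV[R[i]]_1) :
    'rV[R[i]]_n :=
  \row_k (if k == j then w 0 0 else a 0 k).

Definition restr_dom (D : set 'rV[R[i]]_n) (j : 'I_n) (a : 'rV[R[i]]_n) :
    set 'rV[R[i]]_1 :=
  [set w | D (subst_pt a j w)].

Definition restr_fun (F : 'rV[R[i]]_n -> octC R) (j : 'I_n)
    (a : 'rV[R[i]]_n) : 'rV[R[i]]_1 -> octC R :=
  fun w => F (subst_pt a j w).

End OneVariable.

Section WellDefined.
Variable R : realType.
Implicit Types (J K x y : octonion R).

Definition ore (x : octonion R) : R := x.1.1.1.

Definition osqn (x : octonion R) : R :=
  x.1.1.1 ^+ 2 + x.1.1.2 ^+ 2 + x.1.2.1 ^+ 2 + x.1.2.2 ^+ 2 +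
  x.2.1.1 ^+ 2 + x.2.1.2 ^+ 2 + x.2.2.1 ^+ 2 + x.2.2.2 ^+ 2.

Lemma osphereP J : osphere J -> ore J = 0 /\ osqn J = 1.
Proof.
case: J => [[[a b] [c d]] [[e f] [g h]]]; rewrite /osphere /ore /osqn /=.
case=> E0 E1 E2 E3 E4 E5 E6 E7.
have a0 : a = 0.
  have [//|an0] := eqVneq a 0.
  have z0 v : a * v = 0 -> v = 0.
    by move/eqP; rewrite mulf_eq0 (negPf an0) /= => /eqP.
  have b0 : b = 0 by apply: z0; lra.
  have c0 : c = 0 by apply: z0; lra.
  have d0 : d = 0 by apply: z0; lra.
  have e0 : e = 0 by apply: z0; lra.
  have f0 : f = 0 by apply: z0; lra.
  have g0 : g = 0 by apply: z0; lra.
  have h0 : h = 0 by apply: z0; lra.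
  have := sqr_ge0 a; rewrite expr2; subst b c d e f g h; lra.
by split=> //; subst a; rewrite !expr2; lra.
Qed.

Lemma osphere_neq0 J : osphere J -> J != 0.
Proof.
move=> /osphereP[_ J1]; apply/eqP => J0; move/eqP: J1.
by rewrite J0 /osqn /= expr0n /= !addr0 eq_sym oner_eq0.
Qed.

Lemma omulNN x y : omul (- x) (- y) = omul x y.
Proof.
case: x => [[[? ?] [? ?]] [[? ?] [? ?]]].
case: y => [[[? ?] [? ?]] [[? ?] [? ?]]].
by rewrite /omul /cd_mul /cd_conj /=; do ![congr pair]; rewrite /=; ring.
Qed.

Lemma omulx0 x : omul x 0 = 0.
Proof.
case: x => [[[? ?] [? ?]] [[? ?] [? ?]]].
by rewrite /omul /cd_mul /cd_conj /=; do ![congr pair]; rewrite /=; ring.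
Qed.

Lemma slice_coord (a b c d : R) J K : osphere J -> osphere K ->
    a *: oone R + b *: J = c *: oone R + d *: K ->
  [/\ a = c, b *: J = d *: K & b ^+ 2 = d ^+ 2].
Proof.
move=> /osphereP[J0 J1] /osphereP[K0 K1] E.
have ac : a = c.
  have := congr1 ore E; rewrite /ore /= -!/(ore _).
  rewrite -/(ore J) -/(ore K) J0 K0 /GRing.scale /=; lra.
move: E; rewrite ac => /addrI E; split=> //.
have sq (r : R) x : osqn (r *: x) = r ^+ 2 * osqn x.
  by rewrite /osqn /= /GRing.scale /=; ring.
by have := congr1 osqn E; rewrite !sq J1 K1 !mulr1.
Qed.

Lemma slice_liftE (m : nat) (D : set 'rV[R[i]]_m) (F : 'rV[R[i]]_m -> octC R)
    J z : is_stem D F -> osphere J -> D z ->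
  slice_lift D F (slice_pt J z) = (F z).1 + omul J (F z).2.
Proof.
move=> sF sJ Dz; rewrite /slice_lift; case: xgetP; last first.
  by move=> /(_ ((F z).1 + omul J (F z).2)) []; exists J, z.
move=> _ _ [K [w [sK Dw E ->]]].
have {}E t : [/\ complex.Re (z 0 t) = complex.Re (w 0 t),
    complex.Im (z 0 t) *: J = complex.Im (w 0 t) *: K &
    complex.Im (z 0 t) ^+ 2 = complex.Im (w 0 t) ^+ 2].
  by apply: slice_coord => //; move/rowP/(_ t): E; rewrite !mxE.
have [[t Imt]|Im0] := pselect (exists t, complex.Im (z 0 t) != 0); last first.
  have z0 t : complex.Im (z 0 t) = 0.
    by apply/eqP/negPn/negP => ?; apply: Im0; exists t.
  have zr : conj_pt z = z.
    apply/rowP => t; rewrite !mxE; move: (z0 t).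
    by case: (z 0 t) => a b /= ->; rewrite oppr0.
  have wz : w = z.
    apply/rowP => t; have [] := E t; move: (z0 t) => ->.
    rewrite expr0n /=; case: (w 0 t) (z 0 t) (z0 t) => a b [c d] /= -> -> _.
    by move/esym/eqP; rewrite sqrf_eq0 => /eqP ->.
  have F0 : (F z).2 = 0.
    have := sF z Dz; rewrite zr => /(_ Dz) /(congr1 snd) /= E2.
    have : (F z).2 + (F z).2 = 0 by rewrite {1}E2 addNr.
    rewrite -mulr2n -scaler_nat => /eqP.
    by rewrite scaler_eq0 pnatr_eq0 /= => /eqP.
  by rewrite wz F0 !omulx0.
have [_ EJ Esq] := E t.
move/eqP: Esq; rewrite eqf_sqr => /orP[] /eqP EI.
  have JK : J = K by apply: (scalerI Imt); rewrite EJ -EI.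
  suff -> : w = z by rewrite JK.
  apply/rowP => s; have [Er Es _] := E s.
  have : (complex.Im (z 0 s) - complex.Im (w 0 s)) *: K = 0.
    by rewrite scalerBl -{1}JK Es subrr.
  move/eqP; rewrite scaler_eq0 => /orP[|/eqP K0]; last first.
    by have := osphere_neq0 sK; rewrite K0 eqxx.
  rewrite subr_eq0 => /eqP; move: Er.
  by case: (z 0 s) (w 0 s) => a b [c d] /= -> ->.
have JK : J = - K by apply: (scalerI Imt); rewrite EJ EI scaleNr scalerN opprK.
have wz : w = conj_pt z.
  apply/rowP => s; have [Er Es _] := E s; rewrite !mxE.
  have : (complex.Im (z 0 s) + complex.Im (w 0 s)) *: K = 0.
    by rewrite scalerDl -Es JK scalerN subrr.
  move/eqP; rewrite scaler_eq0 => /orP[|/eqP K0]; last first.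
    by have := osphere_neq0 sK; rewrite K0 eqxx.
  rewrite addrC addr_eq0 => /eqP; move: Er.
  by case: (z 0 s) (w 0 s) => a b [c d] /= -> ->.
rewrite wz sF -?wz //= JK; congr (_ + _).
by rewrite -[K in LHS]opprK omulNN.
Qed.

End WellDefined.

(* Main.v *)
(** Coordinatewise, the statement is Hartogs' theorem: a separately holomorphic
function has continuous partial derivatives. Neither Cauchy's integral formula
nor subharmonic functions are used; everything follows from the maximum
principle, itself a consequence of the constancy of circle means.

The maximum principle applies to functions that are merely continuous at
finitely many points, hence to iterated difference quotients. This bounds the
coefficients of a Newton expansion with distinct nodes close to the centre, with
a loss of a factor 2 in the radius. The coefficients are finite combinations of
values of the function, so they are holomorphic in any other variable.

Hartogs' lemma: let |g_k| <= M^k on a square and, at each point, |g_k| <= 1 for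
k large. The closed sets E_N where |g_k| <= 1 for all k >= N exhaust the
boundary, so the complement of some E_N is covered by intervals of small total
length. A product of rational functions of modulus at least 1 on the square, one
per interval, and of modulus at least M on that interval, is close to 1 in the
half square; the maximum principle for the quotient of g_k by the k-th power of
the product bounds g_k there.

Applied to Newton coefficients, this enlarges, one coordinate at a time, a
polydisc of boundedness provided by Baire's argument, and shows by induction on
the number of variables that a separately holomorphic function is locally
bounded. Cauchy estimates then give the continuity of partial derivatives. *)

Require Import Defs.
From mathcomp Require Import all_boot all_order all_algebra.
From mathcomp Require Import complex.
From mathcomp Require Import all_classical all_reals all_analysis.
From mathcomp Require Import ring lra.
Import numFieldNormedType.Exports.
Import ComplexField.Normc.
Import Order.TTheory GRing.Theory Num.Theory.
Set Implicit Arguments. Unset Strict Implicit. Unset Printing Implicit Defensive.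
Local Open Scope classical_set_scope.
Local Open Scope ring_scope.
Local Open Scope complex_scope.

(** * The modulus and the topology of the complex numbers *)

Section Basics.
Variable R : realType.
Notation C := R[i].
Implicit Types (z w : C) (f g : C -> C).

Lemma normc_ge0 z : 0 <= normc z.
Proof. by case: z => a b; exact: sqrtr_ge0. Qed.

Lemma norm_normc z : `|z| = (normc z)%:C.
Proof. by []. Qed.

Lemma normcB z w : normc (z - w) = normc (w - z).
Proof. by rewrite -normcN opprB. Qed.

Lemma le_normcB z w : normc (z - w) <= normc z + normc w.
Proof. by rewrite -(normcN w) le_normcD. Qed.

Lemma normcX z k : normc (z ^+ k) = normc z ^+ k.
Proof. by elim: k => [|k IH]; rewrite ?normc1 // !exprS normcM IH. Qed.

Lemma normc_real (a : R) : normc a%:C = `|a|.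
Proof. by rewrite /= expr0n addr0 sqrtr_sqr. Qed.

Lemma normc_sq z : normc z ^+ 2 = complex.Re z ^+ 2 + complex.Im z ^+ 2.
Proof. by case: z => a b /=; rewrite sqr_sqrtr // addr_ge0 ?sqr_ge0. Qed.

Lemma normc_Re z : `|complex.Re z| <= normc z.
Proof.
case: z => a b /=; rewrite -sqrtr_sqr ler_wsqrtr // lerDl; exact: sqr_ge0.
Qed.

Lemma normc_Im z : `|complex.Im z| <= normc z.
Proof.
case: z => a b /=; rewrite -sqrtr_sqr ler_wsqrtr // lerDr; exact: sqr_ge0.
Qed.

Lemma le_Re_normc z : complex.Re z <= normc z.
Proof. exact: le_trans (ler_norm _) (normc_Re z). Qed.

Lemma normc_le_ReIm z : normc z <= `|complex.Re z| + `|complex.Im z|.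
Proof.
rewrite -(@ler_pXn2r _ 2) ?nnegrE ?normc_ge0 ?addr_ge0 //.
rewrite normc_sq sqrrD !real_normK ?num_real // -addrA lerD2l lerDr.
by rewrite mulrn_wge0 // mulr_ge0.
Qed.

Lemma normc_eq0 z : (normc z == 0) = (z == 0).
Proof. by apply/eqP/eqP => [/eq0_normc|->]; rewrite ?normc0. Qed.

Lemma normc_gt0 z : (0 < normc z) = (z != 0).
Proof. by rewrite lt_neqAle normc_ge0 andbT eq_sym normc_eq0. Qed.

(** The norm of C takes its values in C, so balls have complex radii; a positive complex number is
    real, which allows real radii throughout. *)
Lemma nbhsCP z (A : set C) :
  nbhs z A <-> exists2 e : R, 0 < e & forall w, normc (w - z) < e -> A w.
Proof.
split=> [/nbhs_ballP[e /= e0 eA]|[e e0 eA]].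
  have eE : e = (complex.Re e)%:C by rewrite RRe_real // gtr0_real.
  exists (complex.Re e); first by rewrite -ltcR -eE.
  move=> w wz; apply: eA; rewrite -ball_normE /ball_ /= distrC norm_normc.
  by rewrite eE ltcR.
apply/nbhs_ballP; exists e%:C => /=; first by rewrite ltcR.
move=> w; rewrite -ball_normE /ball_ /= distrC norm_normc ltcR; exact: eA.
Qed.

Lemma continuous_atCP (f : C -> C) z : {for z, continuous f} <->
  forall e : R, 0 < e -> exists2 d : R, 0 < d &
    forall w, normc (w - z) < d -> normc (f w - f z) < e.
Proof.
split=> [cf e e0|H].
  have /nbhsCP[d d0 dA] := cf _ (proj2 (nbhsCP _ _) (ex_intro2 _ _ e e0 (fun w h => h))).
  by exists d.
move=> A /nbhsCP[e e0 eA]; apply/nbhsCP; have [d d0 dA] := H e e0.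
by exists d => // w /dA; exact: eA.
Qed.

Lemma Re_continuous : continuous (@complex.Re R : C -> R).
Proof.
move=> z A /nbhs_ballP[e /= e0 eA]; apply/nbhsCP; exists e => // w wz.
apply: eA; rewrite /ball /= distrC; apply: le_lt_trans wz.
by have := normc_Re (w - z); rewrite raddfB.
Qed.

Lemma Im_continuous : continuous (@complex.Im R : C -> R).
Proof.
move=> z A /nbhs_ballP[e /= e0 eA]; apply/nbhsCP; exists e => // w wz.
apply: eA; rewrite /ball /= distrC; apply: le_lt_trans wz.
by have := normc_Im (w - z); rewrite raddfB.
Qed.

Lemma normc_dist z w : `|normc z - normc w| <= normc (z - w).
Proof.
have H (a b : C) : normc a - normc b <= normc (a - b).
  by rewrite lerBlDr; have := le_normcD (a - b) b; rewrite subrK.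
by rewrite ler_norml H andbT lerNl opprB normcB H.
Qed.

Lemma normc_continuous : continuous (@normc R : C -> R).
Proof.
move=> z A /nbhs_ballP[e /= e0 eA]; apply/nbhsCP; exists e => // w wz.
apply: eA; rewrite /ball /= distrC; apply: le_lt_trans wz; exact: normc_dist.
Qed.

Lemma cvg_complex (T : Type) (F : set_system T) {FF : Filter F} (a b : T -> R)
    (la lb : R) :
  a @ F --> la -> b @ F --> lb -> (fun t => a t +i* b t) @ F --> (la +i* lb : C).
Proof.
move=> aF bF A /nbhsCP[e e0 eA].
have e20 : 0 < e / 2 by rewrite divr_gt0.
have Ha : \forall t \near F, `|la - a t| < e / 2 by move/cvgrPdist_lt: aF; exact.
have Hb : \forall t \near F, `|lb - b t| < e / 2 by move/cvgrPdist_lt: bF; exact.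
apply: filterS2 Ha Hb => t Ha Hb; apply: eA.
apply: le_lt_trans (normc_le_ReIm _) _ => /=.
by rewrite (distrC (a t)) (distrC (b t)) [e]splitr ltrD.
Qed.

End Basics.

(** * Holomorphic functions of one variable *)

Section Holo.
Variable R : realType.
Notation C := R[i].
Implicit Types (z w l : C) (f g : C -> C) (A : set C).

(** Clearing the denominator and using a large inequality include the point [w = z], so that no
    punctured neighbourhood has to be handled later. *)
Lemma is_deriveCP f z l : is_derive z 1 f l <->
  forall e : R, 0 < e -> exists2 d : R, 0 < d & forall w, normc (w - z) < d ->
    normc (f w - f z - l * (w - z)) <= e * normc (w - z).
Proof.
have key w : w != z ->
    normc ((w - z)^-1 * (f w - f z) - l) = normc (f w - f z - l * (w - z)) / normc (w - z).
  move=> wz; have wz0 : w - z != 0 by rewrite subr_eq0.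
  apply: (mulIf (x := normc (w - z))); first by rewrite normc_eq0.
  rewrite divfK ?normc_eq0 // -normcM; congr normc.
  by rewrite mulrBl mulrAC mulVf // mul1r.
split=> [[df dl] e e0|H].
  have {}df : (fun h : C => h^-1 *: ((f \o shift z) (h *: 1) - f z)) @ 0^' --> l.
    by rewrite -dl; exact: df.
  have /df : nbhs l [set u : C | normc (u - l) < e].
    by apply/nbhsCP; exists e.
  rewrite nbhs_nearE /= => /nbhsCP[d d0 dA]; exists d => // w wd.
  have [->|wz] := eqVneq w z.
    by rewrite !subrr mulr0 subrr normc0 mulr0.
  have wz0 : w - z != 0 by rewrite subr_eq0.
  have := dA (w - z); rewrite subr0 => /(_ wd wz0) /=.
  rewrite /GRing.scale /= mulr1 subrK => dAw.
  have {dAw} : normc ((w - z)^-1 * (f w - f z) - l) < e by exact: dAw.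
  rewrite (key w wz) ltr_pdivrMr ?normc_gt0 //.
  exact: ltW.
suff cv : (fun h : C => h^-1 *: ((f \o shift z) (h *: 1) - f z)) @ 0^' --> l.
  by apply: DeriveDef; [apply/cvg_ex; exists l | exact/cvg_lim].
move=> A /nbhsCP[e e0 eA].
have e20 : 0 < e / 2 by rewrite divr_gt0.
have [d d0 dA] := H _ e20.
rewrite nbhs_nearE; apply/nbhsCP; exists d => // h; rewrite subr0 => hd h0.
apply: eA; rewrite /GRing.scale /= mulr1.
have := @key (h + z); rewrite addrK => -> //; last first.
  by rewrite -subr_eq0 addrK.
rewrite ltr_pdivrMr ?normc_gt0 //.
have := dA (h + z); rewrite addrK => /(_ hd) /le_lt_trans; apply.
by rewrite ltr_pM2r ?normc_gt0 // ltr_pdivrMr // mulr_natr mulr2n ltrDl.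
Qed.

Lemma is_derive_continuousC f z l : is_derive z 1 f l -> {for z, continuous f}.
Proof.
by move=> [df _]; apply/differentiable_continuous/derivable1_diffP.
Qed.

Lemma continuous_cmul (a : C) f z : {for z, continuous f} ->
  {for z, continuous (fun w => a * f w)}.
Proof. by move=> cf; apply: (@continuousM _ _ (fun=> a) f z _ cf); exact: cst_continuous. Qed.

(** Differentiability is with respect to all of C, even at boundary points of [A]. Continuity of the
    derivative is included because circle means are differentiated under the integral sign and then
    integrated by the fundamental theorem of calculus. *)
Definition holon A f := exists f' : C -> C, forall z, A z ->
  is_derive z 1 f (f' z) /\ {for z, continuous f'}.

Lemma holonS A B f : A `<=` B -> holon B f -> holon A f.
Proof. by move=> AB [f' H]; exists f' => z /AB /H. Qed.

Lemma holon_continuous A f z : holon A f -> A z -> {for z, continuous f}.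
Proof. by case=> f' H /H[/is_derive_continuousC]. Qed.

Lemma holon_cst A c : holon A (fun=> c).
Proof.
exists (fun=> 0) => z _; split; last exact: cst_continuous.
exact: is_derive_cst.
Qed.

Lemma holon_id A : holon A id.
Proof.
exists (fun=> 1) => z _; split; last exact: cst_continuous.
exact: is_derive_id.
Qed.

Lemma holonD A f g : holon A f -> holon A g -> holon A (fun z => f z + g z).
Proof.
move=> [f' Hf] [g' Hg]; exists (fun z => f' z + g' z) => z Az.
have [df cf] := Hf z Az; have [dg cg] := Hg z Az.
split; first exact: (is_deriveD df dg).
exact: (cvgD cf cg).
Qed.

Lemma holonM A f g : holon A f -> holon A g -> holon A (fun z => f z * g z).
Proof.
move=> [f' Hf] [g' Hg]; exists (fun z => f z * g' z + g z * f' z) => z Az.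
have [df cf] := Hf z Az; have [dg cg] := Hg z Az; split.
  exact: (is_deriveM df dg).
have kf := is_derive_continuousC df; have kg := is_derive_continuousC dg.
exact: (cvgD (cvgM kf cg) (cvgM kg cf)).
Qed.

Lemma eq_holon A f g : f =1 g -> holon A f -> holon A g.
Proof. by move=> /funext ->. Qed.

Lemma holonN A f : holon A f -> holon A (fun z => - f z).
Proof.
move=> /(holonM (holon_cst _ (-1))); apply: eq_holon => z.
by rewrite mulN1r.
Qed.

Lemma holonB A f g : holon A f -> holon A g -> holon A (fun z => f z - g z).
Proof. by move=> Hf /holonN; exact: holonD. Qed.

Lemma holonV A f : (forall z, A z -> f z != 0) -> holon A f ->
  holon A (fun z => (f z)^-1).
Proof.
move=> f0 [f' H]; exists (fun z => - (f z) ^- 2 * f' z) => z Az.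
have [df cf] := H z Az; have cfz := is_derive_continuousC df.
split.
  have dd : derivable f z 1 by case: df.
  apply: DeriveDef; first exact: (derivableV (f0 z Az)).
  by rewrite deriveV ?f0 // derive_val.
have f20 : f z ^+ 2 != 0 by rewrite expf_neq0 ?f0.
have kf2 : f w ^+ 2 @[w --> z] --> f z ^+ 2 by exact: (cvgM cfz cfz).
exact: (cvgM (cvgN (cvgV f20 kf2)) cf).
Qed.

Lemma holonX A f k : holon A f -> holon A (fun z => f z ^+ k).
Proof.
move=> Hf; elim: k => [|k IH]; first exact: holon_cst.
by have := holonM Hf IH; apply: eq_holon => z; rewrite exprS.
Qed.

Lemma holon_prod (I : Type) (r : seq I) A (F : I -> C -> C) :
  (forall i, holon A (F i)) -> holon A (fun z => \prod_(i <- r) F i z).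
Proof.
move=> H; elim: r => [|i r IH].
  by have := holon_cst A 1; apply: eq_holon => z; rewrite big_nil.
by have := holonM (H i) IH; apply: eq_holon => z; rewrite big_cons.
Qed.

Lemma eq_holon_near A f g :
  (forall z, A z -> nbhs z [set w | f w = g w]) -> holon A f -> holon A g.
Proof.
move=> fg [f' H]; exists f' => z Az; have [df cf] := H z Az.
split; last exact: cf.
apply/is_deriveCP => e e0.
have [d d0 dA] := (is_deriveCP f z (f' z)).1 df e e0.
have /nbhsCP[d' d'0 dA'] := fg z Az.
have fgz : f z = g z by apply: dA'; rewrite subrr normc0.
exists (Num.min d d'); first by rewrite lt_min d0.
by move=> w; rewrite lt_min => /andP[/dA wd /dA' <-]; rewrite -fgz.
Qed.

Lemma holon_shift (c : C) A f : holon A f ->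
  holon [set z | A (c + z)] (fun z => f (c + z)).
Proof.
have E z w : c + w - (c + z) = w - z by rewrite opprD addrACA subrr add0r.
move=> [f' H]; exists (fun z => f' (c + z)) => z Az; have [df cf] := H _ Az.
split.
  apply/is_deriveCP => e e0.
  have [d d0 dA] := (is_deriveCP _ _ _).1 df e e0; exists d => // w.
  by have := dA (c + w); rewrite E.
apply/continuous_atCP => e e0.
have [d d0 dA] := (continuous_atCP f' (c + z)).1 cf e e0; exists d => // w.
by have := dA (c + w); rewrite E.
Qed.

(** A chain rule between two fields: [f] is differentiable over C and the path over R.
    Carathéodory's factorization [f w - f z = phi w * (w - z)], with [phi] continuous at [z],
    reduces it to a limit of products. *)
Lemma is_derive_path f z l (p q : R -> R) (t p' q' : R) :
  is_derive t 1 p p' -> is_derive t 1 q q' ->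
  z = p t +i* q t -> is_derive z 1 f l ->
  is_derive t 1 (fun t => complex.Re (f (p t +i* q t)))
    (complex.Re (l * (p' +i* q'))).
Proof.
move=> [dp p'E] [dq q'E] zE df.
pose phi w := if w == z then l else (f w - f z) / (w - z).
have phiE w : f w - f z = phi w * (w - z).
  rewrite /phi; case: eqVneq => [->|wz]; first by rewrite !subrr mulr0.
  by rewrite divfK // subr_eq0.
have phiz : phi z = l by rewrite /phi eqxx.
have cphi : {for z, continuous phi}.
  apply/continuous_atCP => e e0.
  have e20 : 0 < e / 2 by rewrite divr_gt0.
  have [d d0 dA] := (is_deriveCP f z l).1 df _ e20; exists d => // w /dA.
  rewrite phiE -mulrBl normcM phiz.
  have [->|wz] := eqVneq w z; first by rewrite phiz subrr normc0.
  rewrite ler_pM2r ?normc_gt0 ?subr_eq0 // => /le_lt_trans; apply.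
  by rewrite ltr_pdivrMr // mulr_natr mulr2n ltrDl.
have cp : {for t, continuous p} by exact/differentiable_continuous/derivable1_diffP.
have cq : {for t, continuous q} by exact/differentiable_continuous/derivable1_diffP.
have sh : (fun h : R => h + t) @ 0^' --> t.
  have sh0 : h + t @[h --> (0 : R)] --> t.
    by rewrite -[X in _ --> X]add0r; apply: cvgD; [exact: cvg_id|exact: cvg_cst].
  move=> A /sh0; rewrite !nbhs_simpl /= => hA.
  by apply: filterS hA => h.
have cg : (fun h : R => p (h + t) +i* q (h + t)) @ 0^' --> z.
  rewrite zE; have cp' := cvg_comp (fun h => h + t) p sh cp; have cq' := cvg_comp (fun h => h + t) q sh cq.
  exact: (cvg_complex cp' cq').
have c1 : (fun h : R => phi (p (h + t) +i* q (h + t))) @ 0^' --> l.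
  by rewrite -phiz; exact: (cvg_comp (fun h => p (h + t) +i* q (h + t)) phi cg cphi).
have c2 : (fun h : R => (h^-1 * (p (h + t) - p t)) +i* (h^-1 * (q (h + t) - q t))) @ 0^' --> p' +i* q'.
  have dp2 : h^-1 * (p (h + t) - p t) @[h --> 0^'] --> p'.
    rewrite -p'E; have := dp; rewrite /derivable /derive /= /GRing.scale /=.
    by under eq_fun do rewrite mulr1.
  have dq2 : h^-1 * (q (h + t) - q t) @[h --> 0^'] --> q'.
    rewrite -q'E; have := dq; rewrite /derivable /derive /= /GRing.scale /=.
    by under eq_fun do rewrite mulr1.
  exact: cvg_complex.
have c3 : (fun h : R => h^-1 *: (complex.Re (f (p (h + t) +i* q (h + t))) - complex.Re (f (p t +i* q t)))) @ 0^'
   --> complex.Re (l * (p' +i* q')).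
  have c12 := cvg_comp _ (@complex.Re R) (cvgM c1 c2) (@Re_continuous R (l * (p' +i* q'))).
  suff -> : (fun h : R => h^-1 *: (complex.Re (f (p (h + t) +i* q (h + t))) -
      complex.Re (f (p t +i* q t)))) = @complex.Re R \o
    ((fun h : R => phi (p (h + t) +i* q (h + t))) *
     (fun h : R => (h^-1 * (p (h + t) - p t)) +i* (h^-1 * (q (h + t) - q t)))) by exact: c12.
  rewrite funeqE => h /=; rewrite -raddfB -zE phiE zE.
  set w := p (h + t) +i* q (h + t).
  have -> : w - (p t +i* q t) = (p (h + t) - p t) +i* (q (h + t) - q t) by [].
  rewrite [X in _ = complex.Re X](_ : _ = phi w *
    ((h^-1 * (p (h + t) - p t)) +i* (h^-1 * (q (h + t) - q t)))) //.
  by case: (phi w) => a b; rewrite /GRing.scale /=; ring.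
have c4 : h^-1 *: ((fun t0 => complex.Re (f (p t0 +i* q t0))) (h *: 1 + t) -
    complex.Re (f (p t +i* q t))) @[h --> 0^'] --> complex.Re (l * (p' +i* q')).
  by rewrite /GRing.scale /=; under eq_fun do rewrite mulr1.
by apply: DeriveDef; [apply/cvg_ex; eexists; exact: c4|apply/cvg_lim => //; exact: c4].
Qed.

End Holo.

(** * Mean values and the maximum principle *)

Section MeanValue.
Variable R : realType.
Notation C := R[i].
Notation mu := (@lebesgue_measure R).

Lemma continuous_within (T U : topologicalType) (A : set T) (f : T -> U) :
  (forall x, A x -> {for x, continuous f}) -> {within A, continuous f}.
Proof.
by move=> H; apply: continuous_in_subspaceT => x /set_mem /H.
Qed.

(** The derivative in [s] of the integral of [u s] is the integral of [v s], that is
    [W s T - W s 0 = 0]. In the application [s] is a radius, [y] an angle, and the double role of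
    [v] is a Cauchy-Riemann equation in polar coordinates. *)
Lemma integral_const (u v W : R -> R -> R) (a b T M : R) (T0 : 0 < T) :
  (forall s y : R, a < s < b -> is_derive s 1 (u^~ y) (v s y)) ->
  (forall s y : R, a < s < b -> 0 <= y <= T -> `|v s y| <= M) ->
  (forall s : R, a < s < b -> continuous (u s)) ->
  (forall s : R, a < s < b -> continuous (v s)) ->
  (forall s y : R, a < s < b -> is_derive y 1 (W s) (v s y)) ->
  (forall s : R, a < s < b -> W s 0 = W s T) ->
  forall s1 s2 : R, a < s1 -> s1 < s2 -> s2 < b ->
  (\int[mu]_(y in `[0%R, T]) u s1 y = \int[mu]_(y in `[0%R, T]) u s2 y)%R.
Proof.
move=> du vM cu cv dW W0 s1 s2 as1 s12 s2b.
pose F s := (\int[mu]_(y in `[0%R, T]) u s y)%R.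
have iu s : a < s < b -> mu.-integrable `[0, T] (EFin \o u s).
  move=> sab; apply: continuous_compact_integrable; first exact: segment_compact.
  by apply: continuous_subspaceT; exact: cu.
have dF s : a < s < b -> is_derive s 1 F 0.
  move=> sab.
  have mI : measurable (`[0, T]%classic : set (measurableTypeR R)) by [].
  have M0 : 0 <= M by apply: le_trans (normr_ge0 _) (vM s 0 sab _); rewrite lexx ltW.
  have sI : `]a, b[%classic s by rewrite /= in_itv.
  have iu' x : `]a, b[%classic x -> mu.-integrable `[0, T] (EFin \o u x).
    by rewrite /= in_itv; exact: iu.
  have du' x y : `]a, b[%classic x -> `[0, T]%classic y -> derivable (u^~ y) x 1.
    by rewrite /= in_itv /= => xab _; have [] := du x y xab.
  have iM : mu.-integrable `[0, T] (EFin \o (fun=> M)).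
    apply: continuous_compact_integrable; first exact: segment_compact.
    by apply: continuous_subspaceT; exact: cst_continuous.
  have vM' x y : `]a, b[%classic x -> `[0, T]%classic y -> `|partial1of2 u x y| <= M.
    rewrite /= !in_itv /= => xab yT; rewrite partial1of2E.
    by have [_ ->] := du x y xab; exact: vM.
  have cF := cvg_differentiation_under_integral mI sI iu' du' (fun=> M0) iM vM'.
  have E : (\int[mu]_(y in `[0%R, T]) partial1of2 u s y = 0)%R.
    transitivity (\int[mu]_(y in `[0, T]) v s y).
      by apply: eq_Rintegral => y _; rewrite partial1of2E; have [_ ->] := du s y sab.
    have dWd y : derivable (W s) y 1 by have [] := dW s y sab.
    have cW : continuous (W s).
      by move=> y; exact/differentiable_continuous/derivable1_diffP.
    rewrite /Rintegral (continuous_FTC2 T0 (F := W s)).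
    - by rewrite (W0 s sab) subee.
    - by apply: continuous_subspaceT; exact: cv.
    - split; [by move=> y _; exact: dWd| |].
        by apply: cvg_at_right_filter; exact: cW.
      by apply: cvg_at_left_filter; exact: cW.
    - by move=> y _; rewrite derive1E; have [_ ->] := dW s y sab.
  rewrite E in cF.
  have c4 : h^-1 *: (F (h *: 1 + s) - F s) @[h --> (0 : R)^'] --> (0 : R).
    by rewrite /GRing.scale /=; under eq_fun do rewrite mulr1; exact: cF.
  by apply: DeriveDef; [apply/cvg_ex; exists 0; exact: c4|apply/cvg_lim => //; exact: c4].
have cF : {within `[s1, s2], continuous F}.
  apply: continuous_within => x; rewrite /= in_itv /= => /andP[s1x xs2].
  apply/differentiable_continuous/derivable1_diffP.
  by have [] := dF x; rewrite ?(lt_le_trans as1 s1x) ?(le_lt_trans xs2 s2b).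
have [|c _] := MVT s12 (f := F) (df := fun=> 0) _ cF.
  move=> x; rewrite in_itv /= => /andP[s1x xs2].
  by apply: dF; rewrite (lt_trans as1 s1x) (lt_trans xs2 s2b).
by rewrite mul0r => /eqP; rewrite subr_eq0 => /eqP F21; exact: esym F21.
Qed.

(** In the punctured disc the mean of the real part does not depend on the radius, and by continuity
    at the centre it is at least [Re (f z0) - d / 2] on a small circle. *)
Lemma circle_mean_ge (f : C -> C) (z0 : C) (r s d : R) :
  holon [set z | 0 < normc (z - z0) < r] f -> {for z0, continuous f} ->
  0 < s < r -> 0 < d ->
  ~ (forall y : R, complex.Re (f ((complex.Re z0 + s * cos y) +i* (complex.Im z0 + s * sin y)))
       <= complex.Re (f z0) - d).
Proof.
move=> [f' Hf] cf /andP[s0 sr] d0 Hle.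
pose ga (s y : R) : C := (complex.Re z0 + s * cos y) +i* (complex.Im z0 + s * sin y).
have gaE (x y : R) : 0 <= x -> normc (ga x y - z0) = x.
  move=> x0; rewrite /ga; case: (z0) => a b /=.
  have -> : (a + x * cos y - a) ^+ 2 + (b + x * sin y - b) ^+ 2 = x ^+ 2.
    rewrite (addrC a) addrK (addrC b) addrK !exprMn -mulrDr cos2Dsin2 mulr1 //.
  by rewrite sqrtr_sqr ger0_norm.
have d20 : 0 < d / 2 by rewrite divr_gt0.
have [e e0 He] := (continuous_atCP f z0).1 cf _ d20.
pose s' := Num.min (s / 2) (e / 2).
have s'0 : 0 < s' by rewrite lt_min !divr_gt0.
have s's : s' < s by rewrite gt_min ltr_pdivrMr // mulr_natr mulr2n ltrDl s0.
have s'e : s' < e by rewrite gt_min [X in _ || X]ltr_pdivrMr // mulr_natr mulr2n ltrDl e0 orbT.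
(* The open interval from [a] to [b] contains both radii, and its closure stays inside the punctured
   disc, where [f'] is bounded by compactness. *)
pose a := s' / 2; pose b := (s + r) / 2.
have a0 : 0 < a by rewrite divr_gt0.
have as' : a < s' by rewrite ltr_pdivrMr // mulr_natr mulr2n ltrDl.
have sb : s < b by rewrite ltr_pdivlMr // mulr_natr mulr2n ltrD2l.
have br : b < r by rewrite ltr_pdivrMr // mulr_natr mulr2n ltrD2r.
have inA (x y : R) : a <= x <= b -> 0 < normc (ga x y - z0) < r.
  move=> /andP[ax xb]; rewrite gaE ?(le_trans (ltW a0)) //.
  by rewrite (lt_le_trans a0 ax) (le_lt_trans xb br).
have abW (x : R) : a < x < b -> a <= x <= b by move=> /andP[/ltW -> /ltW ->].
pose u x y := complex.Re (f (ga x y)).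
pose v x y := complex.Re (f' (ga x y) * (cos y +i* sin y)).
(* This is the imaginary part of [f] divided by the radius; its angular derivative is the radial
   derivative of the real part. *)
pose W x y := x^-1 * complex.Re (- 'i * f (ga x y)).
have du (x y : R) : a < x < b -> is_derive x 1 (u^~ y) (v x y).
  move=> /abW xab; have [df _] := Hf _ (inA x y xab).
  have d1 : is_derive x 1 (fun x => complex.Re z0 + x * cos y) (cos y).
    by apply: is_derive_eq; rewrite /GRing.scale /=; ring.
  have d2 : is_derive x 1 (fun x => complex.Im z0 + x * sin y) (sin y).
    by apply: is_derive_eq; rewrite /GRing.scale /=; ring.
  exact: (is_derive_path d1 d2 erefl df).
have dW (x y : R) : a < x < b -> is_derive y 1 (W x) (v x y).
  move=> /[dup] /andP[ax _] /abW xab; have [df _] := Hf _ (inA x y xab).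
  have x0 : x != 0 by rewrite gt_eqF // (lt_trans a0 ax).
  have d1 : is_derive y 1 (fun y => complex.Re z0 + x * cos y) (- x * sin y).
    by apply: is_derive_eq; rewrite /GRing.scale /=; ring.
  have d2 : is_derive y 1 (fun y => complex.Im z0 + x * sin y) (x * cos y).
    by apply: is_derive_eq; rewrite /GRing.scale /=; ring.
  have df2 : is_derive (ga x y) 1 (fun w => - 'i * f w) (- 'i * f' (ga x y)).
    exact: (is_deriveZ (- 'i) df).
  have d3 := is_derive_path d1 d2 erefl df2.
  have := is_deriveZ x^-1 d3.
  rewrite /W /v; case: (f' _) => p q.
  set l1 := (X in is_derive _ _ _ X -> _); set l2 := (X in _ -> is_derive _ _ _ X).
  suff -> : l1 = l2 by [].
  rewrite /l1 /l2 /GRing.scale /=; field.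
  exact: x0.
have cga1 (y : R) : continuous (ga^~ y).
  move=> x; apply: cvg_complex; apply: cvgD; try exact: cvg_cst.
    by apply: cvgM; [exact: cvg_id|exact: cvg_cst].
  by apply: cvgM; [exact: cvg_id|exact: cvg_cst].
have cga2 (x : R) : continuous (ga x).
  move=> y; apply: cvg_complex; apply: cvgD; try exact: cvg_cst.
    by apply: cvgM; [exact: cvg_cst|exact: continuous_cos].
  by apply: cvgM; [exact: cvg_cst|exact: continuous_sin].
have cga : continuous (fun xy : R * R => ga xy.1 xy.2).
  move=> [x y]; apply: cvg_complex; apply: cvgD; try exact: cvg_cst.
    by apply: cvgM; [exact: cvg_fst|apply: (cvg_comp (@snd R R) cos); [exact: cvg_snd|exact: continuous_cos]].
  by apply: cvgM; [exact: cvg_fst|apply: (cvg_comp (@snd R R) sin); [exact: cvg_snd|exact: continuous_sin]].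
have cu (x : R) : a < x < b -> continuous (u x).
  move=> /abW xab y; have [df _] := Hf _ (inA x y xab).
  have cfg := is_derive_continuousC df.
  have h1 := cvg_comp (ga x) f (cga2 x y) cfg.
  exact: (cvg_comp _ (@complex.Re R) h1 (@Re_continuous R (f (ga x y)))).
have cv (x : R) : a < x < b -> continuous (v x).
  move=> /abW xab y; have [_ cf'] := Hf _ (inA x y xab).
  have h1 := cvg_comp (ga x) f' (cga2 x y) cf'.
  have h2 : (cos t +i* sin t : C) @[t --> y] --> (cos y +i* sin y : C).
    by apply: cvg_complex; [exact: continuous_cos|exact: continuous_sin].
  exact: (cvg_comp _ (@complex.Re R) (cvgM h1 h2) (@Re_continuous R _)).
pose T := (pi : R) *+ 2.
have T0 : 0 < T by rewrite /T mulrn_wgt0 // pi_gt0.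
(* A bound independent of the radius, to dominate the derivative of the integrand. *)
have [M HM] : exists M : R, forall x y : R, a <= x <= b -> 0 <= y <= T -> normc (f' (ga x y)) <= M.
  pose K : set (R * R) := `[a, b] `*` `[0, T].
  have K0 : K !=set0.
    exists (s, 0); rewrite /K /= !in_itv /= lexx (ltW T0) (ltW sb).
    by rewrite (ltW (lt_trans as' s's)).
  have Kc : compact K by apply: compact_setX; exact: segment_compact.
  have Kf : {within K, continuous (fun xy : R * R => normc (f' (ga xy.1 xy.2)))}.
    apply: continuous_within => -[x y] /= [/= xab _].
    have [_ cf'] := Hf _ (inA x y xab).
    have h1 := cvg_comp (fun xy : R * R => ga xy.1 xy.2) f' (cga (x, y)) cf'.
    exact: (cvg_comp _ (@normc R) h1 (@normc_continuous R _)).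
  have [c _ Hc] := compact_EVT_max K0 Kc Kf.
  exists (normc (f' (ga c.1 c.2))) => x y xab yT.
  by apply: (Hc (x, y)); rewrite inE /K /= !in_itv /=.
have vM (x y : R) : a < x < b -> 0 <= y <= T -> `|v x y| <= M.
  move=> /abW xab yT; apply: le_trans (normc_Re _) _.
  rewrite normcM -[X in _ <= X]mulr1; apply: ler_pM; rewrite ?normc_ge0 //; first exact: HM.
  by rewrite /= cos2Dsin2 sqrtr1.
have W0 (x : R) : a < x < b -> W x 0 = W x T.
  by move=> _; rewrite /W /ga /T cos2pi sin2pi cos0 sin0.
have E := integral_const T0 du vM cu cv dW W0 as' s's sb.
have iu (x : R) : a < x < b -> mu.-integrable `[0, T] (EFin \o u x).
  move=> xab; apply: continuous_compact_integrable; first exact: segment_compact.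
  by apply: continuous_subspaceT; exact: cu.
have ic (k : R) : mu.-integrable `[0, T] (EFin \o (fun=> k)).
  apply: continuous_compact_integrable; first exact: segment_compact.
  by apply: continuous_subspaceT; exact: cst_continuous.
have mT : measurable (`[0, T]%classic : set (measurableTypeR R)) by [].
have ub : \int[mu]_(y in `[0, T]) u s y <= \int[mu]_(y in `[0, T]) (complex.Re (f z0) - d).
  apply: le_Rintegral => //; first by apply: iu; rewrite (lt_trans as' s's).
  by move=> y _; exact: Hle.
have lb : \int[mu]_(y in `[0, T]) (complex.Re (f z0) - d / 2) <= \int[mu]_(y in `[0, T]) u s' y.
  apply: le_Rintegral => //; first by apply: iu; rewrite as' (lt_trans s's).
  move=> y _; rewrite lerBlDr -lerBlDl -raddfB.
  apply: le_trans (le_Re_normc _) _; rewrite normcB; apply: ltW; apply: He.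
  by rewrite gaE // ltW.
have muT : fine (mu `[0, T]%classic) = T.
  by rewrite lebesgue_measure_itv /= lte_fin T0 /= subr0.
move: ub lb; rewrite -E !Rintegral_cst // muT => ub lb.
have := le_trans lb ub; rewrite ler_pM2r // lerD2l lerN2.
by rewrite ler_pdivlMr // mulr_natr mulr2n gerDl leNgt d0.
Qed.

End MeanValue.

Section MaxPrinciple.
Variable R : realType.
Notation C := R[i].

Lemma punctured_ball_avoid (S : seq C) (z : C) :
  exists2 r : R, 0 < r & forall w, 0 < normc (w - z) < r -> w \notin S.
Proof.
elim: S => [|c S [r r0 Hr]]; first by exists 1.
have [->|zc] := eqVneq c z.
  exists r => // w wr; rewrite in_cons negb_or Hr // andbT.
  by rewrite -subr_eq0 -normc_gt0; case/andP: wr.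
exists (Num.min r (normc (c - z))).
  by rewrite lt_min r0 normc_gt0 subr_eq0.
move=> w /andP[w0]; rewrite lt_min => /andP[wr wc].
rewrite in_cons negb_or Hr ?w0 // andbT.
by apply: contraTneq wc => ->; rewrite ltxx.
Qed.

Lemma max_normc (K : set C) (f : C -> C) : K !=set0 -> compact K ->
  (forall z, K z -> {for z, continuous f}) ->
  exists2 c, K c & forall z, K z -> normc (f z) <= normc (f c).
Proof.
move=> K0 Kc cf.
have cF : {within K, continuous (fun z => normc (f z))}.
  apply: continuous_within => z /cf cz.
  exact: (cvg_comp _ (@normc R) cz (@normc_continuous R _)).
have [c /set_mem Kcc Hc] := compact_EVT_max K0 Kc cF.
by exists c => // z Kz; apply: Hc; apply/mem_set.
Qed.

(** If the bound fails at [z0], a rotation makes [f z0] real and positive, and a small multiple of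
    the squared modulus is added. The maximum of the resulting function is then interior and
    contradicts [circle_mean_ge]. A circle mean sees only a punctured disc, so the finite set [S]
    where [f] is merely continuous does no harm. *)
Theorem max_principle (K : set C) (S : seq C) (f : C -> C) (M : R) :
  0 <= M -> compact K -> (forall z, K z -> {for z, continuous f}) ->
  holon (interior K `\` [set` S]) f ->
  (forall z, K z -> ~ interior K z -> normc (f z) <= M) ->
  forall z, K z -> normc (f z) <= M.
Proof.
move=> M0 Kc cf Hf HM z0 Kz0; rewrite leNgt; apply/negP => Mz0.
have K0 : K !=set0 by exists z0.
have [b _ Hb] := max_normc K0 Kc (fun z _ => @cvg_id _ _).
pose B := normc b; pose m := normc (f z0).
have m0 : 0 < m by exact: le_lt_trans M0 Mz0.
pose la : C := (m^-1)%:C * conjc (f z0).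
have la1 : normc la = 1.
  rewrite normcM normc_real ger0_norm ?invr_ge0 ?ltW //.
  have -> : normc (conjc (f z0)) = m by rewrite /m; case: (f z0) => x y /=; rewrite sqrrN.
  by rewrite mulVf ?gt_eqF.
have laf : complex.Re (la * f z0) = m.
  have mm : m ^+ 2 = complex.Re (f z0) ^+ 2 + complex.Im (f z0) ^+ 2 by exact: normc_sq.
  transitivity (m^-1 * m ^+ 2); last by rewrite expr2 mulrA mulVf ?mul1r ?gt_eqF.
  by rewrite mm /la; case: (f z0) => x y /=; ring.
have B1 : 0 < B ^+ 2 + 1 by rewrite ltr_wpDl ?sqr_ge0.
(* Since [ep * B ^+ 2 < m - M], the added term cannot lift a boundary value from [M] to [m]; the
   summand 1 keeps the denominator positive. *)
pose ep := (m - M) / (B ^+ 2 + 1).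
have ep0 : 0 < ep by rewrite divr_gt0 // subr_gt0.
(* No maximum point of phi is interior: the holomorphic function h below
   satisfies Re (h w - h z1) = phi w - phi z1 - ep |w - z1|^2. *)
pose phi z := complex.Re (la * f z) + ep * (normc z) ^+ 2.
have cphi : {within K, continuous phi}.
  apply: continuous_within => z /cf cz.
  have h1 := continuous_cmul (a := la) cz.
  have h2 := cvg_comp _ (@complex.Re R) h1 (@Re_continuous R _).
  have h3 := @normc_continuous R z.
  apply: (@continuousD _ _ _ _ _ z h2).
  apply: (@continuousM _ _ (fun=> ep) (fun z => normc z ^+ 2) z _ (cvgM h3 h3)).
  exact: cst_continuous.
have [z1 /set_mem Kz1 Hz1] := compact_EVT_max K0 Kc cphi.
have {}Hz1 z : K z -> phi z <= phi z1 by move=> Kz; apply: Hz1; apply/mem_set.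
have phi0 : m <= phi z1.
  by apply: le_trans (Hz1 _ Kz0); rewrite /phi laf lerDl mulr_ge0 ?sqr_ge0 ?ltW.
have z1i : interior K z1.
  apply: contrapT => z1b.
  have : phi z1 < m.
    rewrite /phi -ltrBrDr.
    apply: le_lt_trans (le_Re_normc _) _; rewrite normcM la1 mul1r.
    apply: le_lt_trans (HM _ Kz1 z1b) _.
    rewrite ltrBrDr -ltrBrDl.
    apply: (@le_lt_trans _ _ (ep * B ^+ 2)).
      by rewrite ler_pM2l // ler_pXn2r ?nnegrE ?normc_ge0 //; exact: Hb.
    by rewrite /ep mulrAC ltr_pdivrMr // ltr_pM2l ?subr_gt0 // ltrDl.
  by rewrite ltNge phi0.
have [r1 r10 Hr1] := (nbhsCP z1 K).1 z1i.
have [r2 r20 Hr2] := punctured_ball_avoid S z1.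
pose r := Num.min r1 r2.
have r0 : 0 < r by rewrite lt_min r10.
pose h z := la * f z + (2 * ep)%:C * conjc z1 * z.
have oK w : normc (w - z1) < r -> interior K w.
  rewrite lt_min => /andP[wr _]; apply/nbhsCP; exists (r1 - normc (w - z1)).
    by rewrite subr_gt0.
  move=> v; rewrite ltrBrDr => vr; apply: Hr1; apply: le_lt_trans vr.
  by have := le_normcD (v - w) (w - z1); rewrite addrA subrK.
have Hh : holon [set z | 0 < normc (z - z1) < r] h.
  apply: holonD; last first.
    by apply: holonM; [exact: holon_cst|exact: holon_id].
  apply: holonM; first exact: holon_cst.
  apply: holonS Hf => w /= /andP[w0 wr]; split; first exact: oK.
  by apply/negP; apply: Hr2; rewrite w0 /=; move: wr; rewrite lt_min => /andP[].
have ch : {for z1, continuous h}.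
  have h1 := continuous_cmul (a := la) (cf _ Kz1).
  have h2 := continuous_cmul (a := (2 * ep)%:C * conjc z1) (@cvg_id _ (nbhs z1)).
  exact: (cvgD h1 h2).
pose s := r / 2.
have s0 : 0 < s by rewrite divr_gt0.
have sr : 0 < s < r by rewrite s0 /= ltr_pdivrMr // mulr_natr mulr2n ltrDl.
have d0 : 0 < ep * s ^+ 2 by rewrite mulr_gt0 // exprn_gt0.
apply: (circle_mean_ge Hh ch sr d0) => y.
set w := (_ +i* _).
have wE : (complex.Re w - complex.Re z1) ^+ 2 + (complex.Im w - complex.Im z1) ^+ 2 = s ^+ 2.
  rewrite /= (addrC (complex.Re z1)) addrK (addrC (complex.Im z1)) addrK.
  by rewrite !exprMn -mulrDr cos2Dsin2 mulr1.
have Kw : K w.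
  apply: interior_subset; apply: oK.
  have -> : normc (w - z1) = s.
    apply/eqP; rewrite -(eqrXn2 (n := 2)) ?normc_ge0 ?(ltW s0) //.
    by rewrite normc_sq !raddfB wE.
  by case/andP: sr.
clearbody w la; have := Hz1 w Kw; rewrite /phi !normc_sq /h !raddfD /=.
have mE (x1 x2 : C) (k : R) : complex.Re (k%:C * conjc x1 * x2) =
    k * (complex.Re x1 * complex.Re x2 + complex.Im x1 * complex.Im x2).
  by case: x1 x2 => a1 a2 [b1 b2] /=; ring.
move: wE; rewrite -/w !mE.
move: (complex.Re (la * f w)) (complex.Re (la * f z1)) => p q.
move: (complex.Re w) (complex.Im w) (complex.Re z1) (complex.Im z1) => u v a c.
move=> <-; rewrite -subr_ge0 => H; rewrite -subr_ge0.
apply: le_trans H _; rewrite le_eqVlt; apply/orP; left; apply/eqP; ring.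
Qed.

End MaxPrinciple.

(** * Newton expansions *)

Section Newton.
Variable R : realType.
Notation C := R[i].
Implicit Types (f : C -> C) (s : nat -> C) (S : seq C).

Definition square (r : R) : set C :=
  [set z | `|complex.Re z| <= r /\ `|complex.Im z| <= r].

Definition disc (r : R) : set C := [set z | normc z <= r].

Lemma compact_square r : compact (square r).
Proof.
have -> : square r = (fun xy : R * R => (xy.1 +i* xy.2 : C)) @` (`[- r, r] `*` `[- r, r]).
  apply/seteqP; split=> [z [z1 z2]|z [[x y] [/= + +] <-]].
    exists (complex.Re z, complex.Im z); last by case: (z).
    by rewrite /= !in_itv /= -!ler_norml.
  by rewrite !in_itv /= -!ler_norml.
apply: continuous_compact; last by apply: compact_setX; exact: segment_compact.
apply: continuous_within => -[x y] _.
by apply: cvg_complex; [exact: cvg_fst|exact: cvg_snd].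
Qed.

Lemma compact_disc r : compact (disc r).
Proof.
apply: (subclosed_compact _ (@compact_square r)) => [|z zr]; last first.
  by split; apply: le_trans zr; [exact: normc_Re|exact: normc_Im].
apply: (@closed_comp _ _ (@normc R) [set x | x <= r]); last exact: closed_le.
by move=> z _; exact: normc_continuous.
Qed.

Lemma disc_boundary r z : disc r z -> ~ interior (disc r) z -> r <= normc z.
Proof.
move=> _ zi; rewrite leNgt; apply/negP => zr; apply: zi.
apply/nbhsCP; exists (r - normc z); first by rewrite subr_gt0.
move=> w; rewrite ltrBrDr => /ltW; rewrite /disc /=; apply: le_trans.
by have := le_normcD (w - z) z; rewrite subrK.
Qed.

Definition diffq f (c l z : C) := if z == c then l else (f z - f c) / (z - c).

Lemma diffqE f (c l z : C) : f z - f c = diffq f c l z * (z - c).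
Proof.
rewrite /diffq; case: eqVneq => [->|zc]; first by rewrite !subrr mulr0.
by rewrite divfK // subr_eq0.
Qed.

Lemma nbhs_neq (c z : C) : z != c -> nbhs z [set w | w != c].
Proof.
move=> zc; apply/nbhsCP; exists (normc (z - c)); first by rewrite normc_gt0 subr_eq0.
by move=> w; apply: contraTneq => ->; rewrite normcB ltxx.
Qed.

Lemma diffq_continuous f (c l z : C) : is_derive c 1 f l -> {for z, continuous f} ->
  {for z, continuous (diffq f c l)}.
Proof.
move=> df cf; have [->|zc] := eqVneq z c.
  apply/continuous_atCP => e e0.
  have e20 : 0 < e / 2 by rewrite divr_gt0.
  have [d d0 dA] := (is_deriveCP f c l).1 df _ e20; exists d => // w /dA.
  have lE : diffq f c l c = l by rewrite /diffq eqxx.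
  rewrite (diffqE f c l) -mulrBl normcM lE.
  have [->|wc] := eqVneq w c; first by rewrite lE subrr normc0.
  rewrite ler_pM2r ?normc_gt0 ?subr_eq0 // => /le_lt_trans; apply.
  by rewrite ltr_pdivrMr // mulr_natr mulr2n ltrDl.
have E : nbhs z [set w | (f w - f c) * (w - c)^-1 = diffq f c l w].
  by apply: filterS (nbhs_neq zc) => w /= /negPf wc; rewrite /diffq wc.
have c1 : {for z, continuous (fun w => f w - f c)}.
  by apply: (@continuousB _ _ _ f (fun=> f c) z cf); exact: cst_continuous.
have c2 : {for z, continuous (fun w => (w - c)^-1)}.
  apply: (@continuousV _ _ (fun w => w - c) z); first by rewrite subr_eq0.
  by apply: (@continuousB _ _ _ id (fun=> c) z (@cvg_id _ _)); exact: cst_continuous.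
have cc := @continuousM _ _ _ _ _ c1 c2.
have Ez : (f z - f c) * (z - c)^-1 = diffq f c l z.
  by rewrite /diffq (negPf zc).
move=> A; rewrite -Ez => /cc nA; move: E nA; rewrite /=; apply: filterS2.
by move=> w /= <-.
Qed.

Lemma diffq_holon (A : set C) f (c l : C) : holon A f ->
  holon [set z | A z /\ z != c] (diffq f c l).
Proof.
move=> Hf; apply: (@eq_holon_near _ _ (fun z => (f z - f c) / (z - c))).
  move=> z [_ zc]; apply: filterS (nbhs_neq zc) => w /= /negPf wc.
  by rewrite /diffq wc.
apply: holonM.
  by apply: holonB; [apply: holonS Hf => z []|exact: holon_cst].
apply: holonV; first by move=> z [_]; rewrite subr_eq0.
by apply: holonB; [exact: holon_id|exact: holon_cst].
Qed.

(** On the boundary circle the numerator is at most [2 * M] and the denominator at least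
    [rho - del]; the maximum principle carries the bound inside, with [c] added to the exceptional
    points. *)
Lemma diffq_bound f S (c l : C) (rho del M : R) :
  normc c <= del -> del < rho -> is_derive c 1 f l ->
  (forall z, disc rho z -> {for z, continuous f}) ->
  holon (disc rho `\` [set` S]) f ->
  (forall z, disc rho z -> normc (f z) <= M) ->
  forall z, disc rho z -> normc (diffq f c l z) <= M * (2 / (rho - del)).
Proof.
move=> cd dr df cf Hf HM.
have rd0 : 0 < rho - del by rewrite subr_gt0.
have cD : disc rho c by apply: le_trans cd (ltW dr).
have M0 : 0 <= M by apply: le_trans (HM _ cD); exact: normc_ge0.
apply: (@max_principle _ _ (c :: S)).
- by rewrite mulr_ge0 // divr_ge0 // ltW.
- exact: compact_disc.
- by move=> z /cf; exact: diffq_continuous.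
- apply: holonS (diffq_holon c l Hf) => z [zi /= zS]; split; first split.
  + exact: interior_subset.
  + by apply: contra_not zS => zS; rewrite /= in_cons zS orbT.
  + by apply: contra_notN zS => /eqP ->; rewrite /= in_cons eqxx.
- move=> z zD /(disc_boundary zD) rz.
  have zc : rho - del <= normc (z - c).
    rewrite lerBlDr; apply: le_trans rz _.
    by have := le_normcD (z - c) c; rewrite subrK => /le_trans; apply; rewrite lerD2l.
  have zc0 : 0 < normc (z - c) by apply: lt_le_trans zc.
  have zc1 : z != c by rewrite -subr_eq0 -normc_gt0.
  rewrite /diffq (negPf zc1) normcM normcV mulrA; apply: ler_pM.
  + exact: normc_ge0.
  + by rewrite invr_ge0 normc_ge0.
  + rewrite mulr_natr mulr2n; apply: le_trans (le_normcB _ _) _.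
    by apply: lerD; exact: HM.
  + by rewrite lef_pV2 ?posrE.
Qed.

(* [divdiff f s k] need not be differentiable at s 0, ..., s (k - 1); the nodes
   are taken distinct so that it is at s k. *)
Fixpoint divdiff f s k : C -> C :=
  if k is k'.+1 then diffq (divdiff f s k') (s k') ('D_1 (divdiff f s k') (s k'))
  else f.

Lemma notin_nodesS s k z : (z \notin map s (iota 0 k.+1)) =
  (z \notin map s (iota 0 k)) && (z != s k).
Proof. by rewrite -addn1 iotaD map_cat mem_cat negb_or /= inE add0n. Qed.

(** Each quotient costs one factor of [diffq_bound] and adds one node to the exceptional set;
    injectivity keeps the next node outside that set. *)
Lemma divdiffP f s (rho del M : R) k : injective s ->
  (forall j, normc (s j) <= del) -> del < rho ->
  holon (disc rho) f -> (forall z, disc rho z -> normc (f z) <= M) ->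
  [/\ forall z, disc rho z -> {for z, continuous (divdiff f s k)},
      holon (disc rho `\` [set` map s (iota 0 k)]) (divdiff f s k) &
      forall z, disc rho z ->
        normc (divdiff f s k z) <= M * (2 / (rho - del)) ^+ k].
Proof.
move=> sI sd dr Hf HM; elim: k => [|k [IHc IHh IHb]].
  split=> [z zD| |]; [exact: holon_continuous Hf zD| |by move=> z; rewrite mulr1; exact: HM].
  by apply: holonS Hf => z [].
have sD j : disc rho (s j) by apply: le_trans (sd j) (ltW dr).
have sk : (disc rho `\` [set` map s (iota 0 k)]) (s k).
  split=> //= /mapP[j]; rewrite mem_iota add0n => /andP[_ jk] /sI kj.
  by rewrite kj ltnn in jk.
have df : is_derive (s k) 1 (divdiff f s k) ('D_1 (divdiff f s k) (s k)).
  by case: IHh => f' /(_ _ sk)[[df _] _]; exact: DeriveDef.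
split.
- by move=> z /IHc; exact: diffq_continuous.
- apply: holonS (diffq_holon (s k) _ IHh) => z [zD] /negP.
  by rewrite notin_nodesS => /andP[/negP zS zk].
- move=> z zD; rewrite exprSr [X in _ <= X]mulrA.
  exact: (diffq_bound (sd k) dr df IHc IHh IHb).
Qed.

Lemma newton_expansion f s k z : f z =
  \sum_(i < k) divdiff f s i (s i) * \prod_(j < i) (z - s j) +
  divdiff f s k z * \prod_(j < k) (z - s j).
Proof.
elim: k => [|k IH]; first by rewrite !big_ord0 add0r mulr1.
rewrite {1}IH !big_ord_recr /= -addrA; congr (_ + _).
rewrite [_ * (z - s k)]mulrC mulrA -diffqE mulrBl addrC subrK //.
Qed.

(** Off the nodes, a divided difference is a linear combination, with coefficients independent of
    [w], of values of [f] at [z] and at nodes. The derivatives that fill in the quotients at the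
    nodes do not enter. *)
Lemma divdiff_holon (B Z : set C) (f : C -> C -> C) s k z :
  (forall j, Z (s j)) -> Z z -> injective s -> z \notin map s (iota 0 k) ->
  (forall z, Z z -> holon B (f z)) ->
  holon B (fun w => divdiff (f^~ w) s k z).
Proof.
move=> Zs Zz sI + Hf; elim: k z Zz => [|k IH] z Zz; first by move=> _; exact: Hf.
rewrite notin_nodesS => /andP[zS zk].
have sk : s k \notin map s (iota 0 k).
  apply/mapP => -[j]; rewrite mem_iota add0n => /andP[_ jk] /sI kj.
  by rewrite kj ltnn in jk.
rewrite /= /diffq (negPf zk); apply: holonM; last exact: holon_cst.
by apply: holonB; exact: IH.
Qed.

End Newton.

(** * Hartogs' lemma *)

Section Covering.
Variable R : realType.
Notation mu := (@lebesgue_measure R).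

(** The sets [[-T, T]] minus [E N] decrease to the empty set, so their measure tends to 0; outer
    regularity then gives a cover by open intervals of small total length. *)
Lemma small_cover (T eta : R) (E : nat -> set R) :
  (forall N, closed (E N)) -> (forall N M, (N <= M)%N -> E N `<=` E M) ->
  (forall t, `|t| <= T -> exists N, E N t) -> 0 < eta ->
  exists (N : nat) (c r : nat -> R),
    (forall n, \sum_(m < n) r m <= eta) /\
    (forall m, 0 <= r m) /\
    (forall t, `|t| <= T -> ~ E N t -> exists m, `|t - c m| < r m).
Proof.
move=> cE ndE covE eta0.
pose U N : set R := `[- T, T] `\` E N.
have mU N : measurable (U N).
  by apply: measurableD; [exact: measurable_itv|exact: measurable_realfun.closed_measurable].
have U0 : \bigcap_N U N = set0.
  rewrite -subset0 => t Ut.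
  have [t1 _] := Ut 0%N I.
  have [N EN] : exists N, E N t by apply: covE; rewrite ler_norml; move: t1; rewrite /= in_itv.
  by have [_] := Ut N I.
have muU0 : (mu (U 0%N) < +oo)%E.
  apply: (@le_lt_trans _ _ (mu `[- T, T])).
    by apply: le_measure; rewrite ?inE; [exact: mU|exact: measurable_itv|exact: subDsetl].
  by rewrite lebesgue_measure_itv /=; case: ifP => _; rewrite ?ltry // -EFinD ltry.
have niU : {homo U : n m / (n <= m)%N >-> (m <= n)%O}.
  by move=> n m nm; apply/subsetPset => t [t1 t2]; split => // /(ndE _ _ nm).
have mI : measurable (\bigcap_N U N) by rewrite U0.
have := nonincreasing_cvg_mu muU0 mU mI niU.
rewrite U0 measure0 => /fine_cvgP[fU cU].
have [N _ HN] : \forall N \near \oo, (mu (U N) < eta%:E)%E.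
  move/cvgrPdist_lt : cU => /(_ _ eta0) cU.
  near=> N.
  have fN : mu (U N) \is a fin_num by near: N.
  have : `|0 - fine (mu (U N))| < eta by near: N.
  rewrite sub0r normrN => /(le_lt_trans (ler_norm _)).
  by rewrite -lte_fin fineK.
have {}HN := HN N (leqnn N).
have : ((wlength idfun)^*%mu (U N) < eta%:E)%E by exact: HN.
rewrite measurable_realfun.outer_measure_open_itv_cover => /ereal_inf_lt[_ [F [Fo FU] <-] Fe].
have [ab Fab] := choice Fo.
(* Midpoints and half-lengths; the maximum with 0 gives radius 0 to an interval whose endpoints are
   in the wrong order. *)
exists N, (fun k => ((ab k).1 + (ab k).2) / 2), (fun k => Num.max 0 (((ab k).2 - (ab k).1) / 2)).
split; [|split].
- move=> n; rewrite -lee_fin; apply: le_trans (ltW Fe).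
  apply: le_trans (nneseries_lim_ge n _); last first.
    by move=> m _ _; exact: wlength_ge0.
  rewrite -sumEFin big_mkord; apply: lee_sum => m _.
  rewrite Fab wlength_itv /= lte_fin; case: ltP => [lt|le]; last first.
    by rewrite lee_fin ge_max lexx ler_pdivrMr // mul0r subr_le0.
  rewrite -EFinB lee_fin ge_max subr_ge0 (ltW lt) /= ler_pdivrMr //.
  by rewrite mulr_natr mulr2n lerDl subr_ge0 ltW.
- by move=> m; rewrite le_max lexx.
- move=> t tT nE; have [k _] : (\bigcup_k F k) t.
    by apply: FU; split => //; rewrite /= in_itv /= -ler_norml.
  rewrite Fab /= in_itv /= => /andP[a1 a2]; exists k.
  rewrite lt_max; apply/orP; right; rewrite ltr_norml; lra.
Unshelve. all: by end_near. Qed.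

Lemma finite_cover (K : set R) (c r : nat -> R) : compact K ->
  (forall t, K t -> exists m, `|t - c m| < r m) ->
  exists n, forall t, K t -> exists2 m, (m < n)%N & `|t - c m| < r m.
Proof.
rewrite compact_cover => cK cov.
have [||D _ HD] := cK nat setT (fun m => [set t | `|t - c m| < r m]).
- move=> m _; have -> : [set t | `|t - c m| < r m] = ball (c m) (r m).
    by apply/seteqP; split=> t /=; rewrite /ball /= distrC.
  exact: ball_open.
- by move=> t /cov[m mt]; exists m.
exists (\max_(m <- finmap.enum_fset D) m).+1 => t /HD[m /= mD mt]; exists m => //.
have mD' : m \in finmap.enum_fset D by [].
by rewrite ltnS (big_rem m) //= leq_maxl.
Qed.

End Covering.

(** * Rational functions that are large near a given boundary interval *)

Section Majorants.
Variable R : realType.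
Notation C := R[i].

Lemma normc_prod (I : Type) (r : seq I) (P : pred I) (F : I -> C) :
  normc (\prod_(i <- r | P i) F i) = \prod_(i <- r | P i) normc (F i).
Proof. by apply: big_morph; [exact: normcM|exact: normc1]. Qed.

Lemma le_prod_factor (I : finType) (F : I -> R) j :
  (forall i, 1 <= F i) -> F j <= \prod_i F i.
Proof.
move=> F1; rewrite (bigD1 j) //= ler_peMr ?(le_trans ler01) //.
elim/big_ind: _ => // x y x1 y1.
by rewrite -[X in X <= _]mulr1; apply: ler_pM.
Qed.

Lemma prod_ge1 (I : finType) (F : I -> R) : (forall i, 1 <= F i) -> 1 <= \prod_i F i.
Proof.
move=> F1; elim/big_ind: _ => // x y x1 y1.
by rewrite -[X in X <= _]mulr1; apply: ler_pM.
Qed.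

Lemma prod_le_exp (I : finType) (F x : I -> R) : (forall i, 0 <= F i <= 1 + x i) ->
  \prod_i F i <= expR (\sum_i x i).
Proof.
move=> Fx; rewrite expR_sum; apply: ler_prod => i _.
have /andP[-> /= Fxi] := Fx i; apply: le_trans Fxi _; exact: expR_ge1Dx.
Qed.

Lemma complex_ext (u v : C) : complex.Re u = complex.Re v ->
  complex.Im u = complex.Im v -> u = v.
Proof. by case: u v => a b [c d] /= -> ->. Qed.

(* The outward normals of the four sides of a square centred at 0. *)
Definition normal (b : bool * bool) : C := (-1) ^+ b.2 * (if b.1 then 'i else 1).

Lemma normc_normal b : normc (normal b) = 1.
Proof.
rewrite normcM normcX normcN normc1 expr1n mul1r.
by case: b.1; rewrite ?normc1 //= expr0n add0r expr1n sqrtr1.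
Qed.

Lemma Re_normal_square (s : R) b w : square s w -> complex.Re (conjc (normal b) * w) <= s.
Proof.
case: w => u v [/=]; rewrite !ler_norml => /andP[u1 u2] /andP[v1 v2].
by case: b => -[] []; rewrite /normal /= ?expr0 ?expr1 /=; lra.
Qed.

Lemma square_boundary (s : R) w : 0 < s -> square s w -> ~ interior (square s) w ->
  exists b (t : R), `|t| <= s /\ w = normal b * (s +i* t).
Proof.
move=> s0 [ws1 ws2] wi.
have [/eqP E1|n1] := boolP (`|complex.Re w| == s).
  have [w0|w0] := leP 0 (complex.Re w).
    exists (false, false), (complex.Im w); split => //.
    rewrite /normal expr0 !mul1r -E1 ger0_norm //; by case: (w).
  exists (false, true), (- complex.Im w); split; first by rewrite normrN.
  rewrite /normal expr1 mulr1 -E1 ltr0_norm // mulN1r; case: (w) => a b /=.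
  by apply: complex_ext => /=; ring.
have [/eqP E2|n2] := boolP (`|complex.Im w| == s).
  have [w0|w0] := leP 0 (complex.Im w).
    exists (true, false), (- complex.Re w); split; first by rewrite normrN.
    rewrite /normal expr0 !mul1r -E2 ger0_norm //; case: (w) => a b /=.
    by apply: complex_ext => /=; ring.
  exists (true, true), (complex.Re w); split => //.
  rewrite /normal expr1 -E2 ltr0_norm // mulN1r; case: (w) => a b /=.
  by apply: complex_ext => /=; ring.
case: wi; apply/nbhsCP.
have l1 : `|complex.Re w| < s by rewrite lt_neqAle n1.
have l2 : `|complex.Im w| < s by rewrite lt_neqAle n2.
exists (Num.min (s - `|complex.Re w|) (s - `|complex.Im w|)).
  by rewrite lt_min !subr_gt0 l1.
move=> z; rewrite lt_min => /andP[z1 z2]; split.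
- have := ler_normD (complex.Re z - complex.Re w) (complex.Re w); rewrite subrK.
  move/le_trans; apply; rewrite -lerBrDr; apply: ltW; apply: le_lt_trans z1.
  by rewrite -raddfB; exact: normc_Re.
- have := ler_normD (complex.Im z - complex.Im w) (complex.Im w); rewrite subrK.
  move/le_trans; apply; rewrite -lerBrDr; apply: ltW; apply: le_lt_trans z2.
  by rewrite -raddfB; exact: normc_Im.
Qed.

Section Majorant.
Variables (s M : R).
Hypotheses (s0 : 0 < s) (M1 : 1 <= M).

(* For w in the square, v := r + (s + i c) - conj n w has real part at least r,
   so the modulus is at least 1; moreover 2 r Re (1 / v) >= 1 at the points of
   the side of normal n whose parameter is at distance less than r from c. *)
Definition spike (b : bool * bool) (c r : R) (w : C) : C :=
  1 + (2 * r * M)%:C / ((r + s) +i* c - conjc (normal b) * w).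

Lemma spike_re b c r w : square s w -> 0 < r ->
  r <= complex.Re ((r + s) +i* c - conjc (normal b) * w).
Proof.
move=> sw r0; have := Re_normal_square b sw; rewrite raddfB /=; lra.
Qed.

Lemma spike_holon b c r : 0 < r -> holon (square s) (spike b c r).
Proof.
move=> r0; apply: holonD; first exact: holon_cst.
apply: holonM; first exact: holon_cst.
apply: holonV.
  move=> w sw; apply/eqP => E; have := spike_re b c sw r0.
  by rewrite E /= leNgt r0.
apply: holonB; first exact: holon_cst.
by apply: holonM; [exact: holon_cst|exact: holon_id].
Qed.

Lemma Re_div_gt (k : R) (v : C) : complex.Re (k%:C / v) =
  k * complex.Re v / normc v ^+ 2.
Proof. rewrite normc_sq; case: v => x y /=; ring. Qed.

Lemma spike_ge1 b c r w : square s w -> 0 < r -> 1 <= normc (spike b c r w).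
Proof.
move=> sw r0; apply: le_trans (le_Re_normc _).
rewrite /spike raddfD /= lerDl Re_div_gt divr_ge0 ?sqr_ge0 // mulr_ge0 //.
  by rewrite !mulr_ge0 ?(ltW r0) ?(le_trans ler01 M1).
by apply: le_trans (spike_re _ _ sw r0); exact: ltW.
Qed.

Lemma spike_side b c r t : `|t| <= s -> `|t - c| < r ->
  M <= normc (spike b c r (normal b * (s +i* t))).
Proof.
move=> ts tc; have r0 : 0 < r by apply: le_lt_trans tc.
apply: le_trans (le_Re_normc _).
have E : conjc (normal b) * (normal b * (s +i* t)) = s +i* t.
  rewrite mulrA; have -> : conjc (normal b) * normal b = 1.
    rewrite mulrC -sqr_normc; have := normc_normal b.
    by rewrite norm_normc => ->; rewrite expr1n.
  by rewrite mul1r.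
rewrite /spike E raddfD [X in _ + X]Re_div_gt normc_sq /=.
have [c1 c2] : - r < t - c /\ t - c < r by move: tc; rewrite ltr_norml => /andP[].
have D0 : 0 < (r + s - s) ^+ 2 + (c - t) ^+ 2.
  by rewrite addrK ltr_pwDl ?exprn_gt0 ?sqr_ge0.
rewrite -lerBlDl ler_pdivlMr // addrK.
have ct : (c - t) ^+ 2 <= r ^+ 2.
  have : 0 <= (r - (t - c)) * (r + (t - c)) by apply: mulr_ge0; lra.
  lra.
apply: (@le_trans _ _ (M * (r ^+ 2 + (c - t) ^+ 2))).
  by rewrite ler_wpM2r ?addr_ge0 ?sqr_ge0 // lerBlDr lerDl.
apply: (@le_trans _ _ (M * (r ^+ 2 + r ^+ 2))).
  by rewrite ler_wpM2l ?lerD2l // (le_trans ler01).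
by rewrite le_eqVlt; apply/orP; left; apply/eqP; ring.
Qed.

(** In the half square the denominator has real part at least [s / 2]. The excess over 1 is
    therefore linear in [r], and a product over intervals is controlled by their total length. *)
Lemma spike_le b c r w : square (s / 2) w -> 0 < r ->
  normc (spike b c r w) <= 1 + 4 * M / s * r.
Proof.
move=> sw r0; have s20 : 0 < s / 2 by rewrite divr_gt0.
apply: le_trans (le_normcD _ _) _; rewrite normc1 lerD2l normcM normcV normc_real.
have M0 : 0 <= M by exact: le_trans ler01 M1.
rewrite ger0_norm; last by rewrite mulr_ge0 // mulr_ge0 // ltW.
have v2 : s / 2 <= normc ((r + s) +i* c - conjc (normal b) * w).
  apply: le_trans (le_Re_normc _); have := Re_normal_square b sw.
  rewrite raddfB /=; lra.
apply: (@le_trans _ _ (2 * r * M * (s / 2)^-1)).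
  rewrite ler_wpM2l ?lef_pV2 ?posrE //; last exact: lt_le_trans v2.
  by rewrite mulr_ge0 // mulr_ge0 // ltW.
by rewrite le_eqVlt; apply/orP; left; apply/eqP; field; rewrite gt_eqF.
Qed.

End Majorant.

End Majorants.

(** * From pointwise to uniform bounds *)

Section HartogsLemma.
Variable R : realType.
Notation C := R[i].

Lemma square_boundary_sub (s : R) b t : 0 < s -> `|t| <= s ->
  square s (normal R b * (s +i* t)).
Proof.
move=> s0 ts; rewrite /square /= /normal.
by case: b => -[] [] /=; rewrite ?expr0 ?expr1 /=;
  rewrite ?(mulN1r, mul1r, mulr1, mul0r, mulr0, oppr0, add0r, addr0, subr0, sub0r, normrN) /=;
  rewrite ?(mulN1r, mul1r, mulr1, mul0r, mulr0, oppr0, add0r, addr0, subr0, sub0r, normrN, mulNr);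
  rewrite ?[`|s|]gtr0_norm.
Qed.

(** The index [x] will carry the remaining variables, and the threshold is uniform in it. One power
    of [tau] bounds the quotient on the boundary of the square, the other bounds the majorant in the
    half square. *)
Theorem hartogs_lemma (X : Type) (g : X -> nat -> C -> C) (s M tau : R) :
  0 < s -> 1 <= M -> 1 < tau ->
  (forall x k, holon (square s) (g x k)) ->
  (forall x k w, (0 < k)%N -> square s w -> normc (g x k w) <= M ^+ k) ->
  (forall w, square s w -> exists N, forall k, (N <= k)%N ->
    forall x, normc (g x k w) <= 1) ->
  exists N, forall k, (N <= k)%N -> forall x w, square (s / 2) w ->
    normc (g x k w) <= (tau * tau) ^+ k.
Proof.
move=> s0 M1 tau1 Hg gM gN.
have M0 : 0 < M by exact: lt_le_trans ltr01 M1.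
have tau0 : 0 < tau by exact: lt_trans tau1.
(* With this total radius, the factors of one side contribute at most [expR (ln tau / 4)] in the
   half square, hence the four sides at most [tau]. *)
have eta0 : 0 < s * ln tau / (16 * M) by rewrite divr_gt0 ?mulr_gt0 // ln_gt0.
set eta := _ / _ in eta0.
pose pt b t := normal R b * (s +i* t).
have ptc b : continuous (pt b).
  move=> t; apply: (@continuousM _ _ (fun=> normal R b)); first exact: cst_continuous.
  by apply: cvg_complex; [exact: cvg_cst|exact: cvg_id].
have gc x k b t : `|t| <= s -> {for t, continuous (fun t => normc (g x k (pt b t)))}.
  move=> ts; have sq := square_boundary_sub b s0 ts.
  have h1 := cvg_comp (pt b) (g x k) (ptc b t) (holon_continuous (Hg x k) sq).
  exact: (cvg_comp _ (@normc R) h1 (@normc_continuous R _)).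
have itvE (t : R) : (t \in `[- s, s]) = (`|t| <= s) by rewrite in_itv /= ler_norml.
have gcl x k b (A : set R) : closed A ->
    closed [set t | `|t| <= s /\ A (normc (g x k (pt b t)))].
  move=> cA.
  have : {within `[- s, s], continuous (fun t => normc (g x k (pt b t)))}.
    by apply: continuous_within => t; rewrite /= itvE; exact: gc.
  move/continuousP => /(_ (~` A) (closed_openC cA)) /open_subspaceP[V oV VE].
  have -> : [set t | `|t| <= s /\ A (normc (g x k (pt b t)))] = `[- s, s] `\` V.
    apply/seteqP; split=> t /=; rewrite itvE => -[ts At]; split=> //.
      move=> Vt; have : (V `&` `[- s, s]) t by split => //=; rewrite itvE.
      by rewrite VE => -[] /(_ At).
    apply: contrapT => nA; apply: At.
    have : ((fun t => normc (g x k (pt b t))) @^-1` (~` A) `&` `[- s, s]) t.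
      by split => //=; rewrite itvE.
    by rewrite -VE => -[].
  by apply: closedI; [exact: interval_closed|exact: open_closedC].
(* The condition on [t] is kept inside because continuity is known only along the side; each set of
   the intersection is then closed. *)
pose E b N : set R := [set t | forall x k, (N <= k)%N -> `|t| <= s /\ normc (g x k (pt b t)) <= 1].
have cov b : exists Ncr : nat * (nat -> R) * (nat -> R),
    (forall n, \sum_(m < n) Ncr.2 m <= eta) /\ (forall m, 0 <= Ncr.2 m) /\
    (forall t, `|t| <= s -> ~ E b Ncr.1.1 t -> exists m, `|t - Ncr.1.2 m| < Ncr.2 m).
  have [||||N [c [r H]]] := @small_cover _ s eta (E b); last by exists (N, c, r).
  - move=> N; have -> : E b N = \bigcap_(xk in [set xk : X * nat | (N <= xk.2)%N])
        [set t | `|t| <= s /\ normc (g xk.1 xk.2 (pt b t)) <= 1].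
      apply/seteqP; split=> t /= Et; first by move=> [x k] /= Nk; exact: Et.
      by move=> x k Nk; exact: (Et (x, k)).
    by apply: closed_bigI => -[x k] _; apply: (gcl x k b [set u | u <= 1]); exact: closed_le.
  - by move=> N N' NN' t Et x k N'k; apply: Et; exact: leq_trans NN' N'k.
  - move=> t ts; have [N HN] := gN _ (square_boundary_sub b s0 ts).
    by exists N => x k Nk; split => //; exact: HN.
  - exact: eta0.
have [Ncr HNcr] := choice cov.
(* The successor forces [k] to be positive, as the bound by [M ^+ k] and the inequality
   [1 < tau ^+ k] require. *)
exists (\max_b (Ncr b).1.1).+1 => k Nk x.
have k0 : (0 < k)%N by exact: leq_ltn_trans Nk.
have NkE b : ((Ncr b).1.1 <= k)%N.
  by apply: leq_trans (ltnW Nk); exact: (leq_bigmax (F := fun b => (Ncr b).1.1)).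
set f := g x k.
(* For fixed [k] and [x], the points of a side where [f] is at least [tau ^+ k] in modulus form a
   compact set outside [E], so finitely many intervals cover it. Their number may depend on [k] and
   [x], as all partial sums of the radii are at most [eta]. *)
have [n Hn] : exists n : nat, forall b t, `|t| <= s -> tau ^+ k <= normc (f (pt b t)) ->
    exists2 m, (m < n)%N & `|t - (Ncr b).1.2 m| < (Ncr b).2 m.
  have fin b : exists n, forall t, `|t| <= s /\ tau ^+ k <= normc (f (pt b t)) ->
      exists2 m, (m < n)%N & `|t - (Ncr b).1.2 m| < (Ncr b).2 m.
    apply: (@finite_cover _ [set t | `|t| <= s /\ tau ^+ k <= normc (f (pt b t))]).
      apply: (subclosed_compact _ (@segment_compact _ (- s) s)).
        by apply: (gcl x k b [set u | tau ^+ k <= u]); exact: closed_ge.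
      by move=> t [ts _]; rewrite /= itvE.
    move=> t [ts ft]; have [_ [_ H]] := HNcr b; apply: H => // Et.
    have [_] := Et x k (NkE b); rewrite leNgt => /negP; apply.
    by apply: lt_le_trans ft; rewrite exprn_egt1 // -lt0n.
  have [nb Hnb] := choice fin.
  exists (\max_b nb b) => b t ts ft; have [m mn mt] := Hnb b t (conj ts ft).
  by exists m => //; apply: leq_trans mn _; exact: (leq_bigmax b).
(* An interval of radius 0 is empty and contributes the factor 1, since a spike requires a positive
   radius. *)
pose H (b : bool * bool) (m : nat) (w : C) : C :=
  if 0 < (Ncr b).2 m then spike s M b ((Ncr b).1.2 m) ((Ncr b).2 m) w else 1.
have H1 b m w : square s w -> 1 <= normc (H b m w).
  by move=> sw; rewrite /H; case: ifP => r0; [exact: spike_ge1|rewrite normc1].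
have Hh b m : holon (square s) (H b m).
  have [r0|r0] := ltP 0 ((Ncr b).2 m).
    by apply: (eq_holon _ (spike_holon s M b ((Ncr b).1.2 m) r0)) => w; rewrite /H r0.
  by apply: (eq_holon _ (@holon_cst _ (square s) 1)) => w; rewrite /H ltNge r0.
pose G (w : C) := \prod_(b : bool * bool) \prod_(m < n) H b m w.
have Gh : holon (square s) G.
  by apply: holon_prod => b; apply: holon_prod => m; exact: Hh.
have GE w : normc (G w) = \prod_(b : bool * bool) \prod_(m < n) normc (H b m w).
  by rewrite normc_prod; apply: eq_bigr => b _; rewrite normc_prod.
have Gb w b : square s w -> 1 <= \prod_(m < n) normc (H b m w).
  by move=> sw; apply: prod_ge1 => m; exact: H1.
have G1 w : square s w -> 1 <= normc (G w).
  by move=> sw; rewrite GE; apply: prod_ge1 => b; exact: Gb.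
have GM b t : `|t| <= s -> tau ^+ k <= normc (f (pt b t)) -> M <= normc (G (pt b t)).
  move=> ts ft; have sq := square_boundary_sub b s0 ts.
  have [m mn mt] := Hn b t ts ft.
  rewrite GE; apply: le_trans (le_prod_factor b _); last by move=> b'; exact: Gb.
  apply: le_trans (le_prod_factor (Ordinal mn) _); last by move=> m'; exact: H1.
  rewrite /= /H (le_lt_trans (normr_ge0 _) mt).
  exact: spike_side.
have Gle w : square (s / 2) w -> normc (G w) <= tau.
  move=> sw; have sw' : square s w.
    case: sw => w1 w2; split; [apply: le_trans w1 _|apply: le_trans w2 _];
      by rewrite ler_pdivrMr // mulr_natr mulr2n lerDl ltW.
  have HH b m : normc (H b m w) <= 1 + 4 * M / s * (Ncr b).2 m.
    rewrite /H; case: ifP => r0; first exact: spike_le.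
    have rm : 0 <= (Ncr b).2 m by case: (HNcr b) => _ [].
    by rewrite normc1 lerDl mulr_ge0 // divr_ge0 ?(ltW s0) // mulr_ge0 // ltW.
  rewrite -[leRHS]lnK ?posrE //.
  rewrite GE; apply: (@le_trans _ _ (\prod_(b : bool * bool) expR (ln tau / 4))).
    apply: ler_prod => b _; rewrite (le_trans ler01 (Gb w b sw')) /=.
    apply: le_trans (prod_le_exp (x := fun m : 'I_n => 4 * M / s * (Ncr b).2 m) _) _.
      by move=> m; rewrite HH andbT (le_trans ler01 (H1 _ _ _ sw')).
    rewrite ler_expR -mulr_sumr.
    have [+ _] := HNcr b => /(_ n) Hs.
    apply: (@le_trans _ _ (4 * M / s * eta)).
      by rewrite ler_wpM2l // divr_ge0 ?mulr_ge0 // ltW.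
    rewrite le_eqVlt; apply/orP; left; apply/eqP; rewrite /eta; field.
    by rewrite !gt_eqF.
  rewrite prodr_const card_prod card_bool -expRM_natl ler_expR.
  rewrite le_eqVlt; apply/orP; left; apply/eqP; by field.
pose q w := f w / G w ^+ k.
have qh : holon (square s) q.
  apply: holonM; first exact: Hg.
  apply: holonV; last exact: holonX.
  move=> z sz; rewrite expf_neq0 // -normc_gt0; exact: lt_le_trans ltr01 (G1 z sz).
have qb : forall w, square s w -> normc (q w) <= tau ^+ k.
  apply: (@max_principle _ _ [::]).
  - by rewrite exprn_ge0 // ltW.
  - exact: compact_square.
  - by move=> w sw; exact: holon_continuous qh sw.
  - by apply: holonS qh => w [+ _]; exact: interior_subset.
  - move=> w sw /(square_boundary s0 sw)[b [t [ts wE]]].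
    rewrite wE in sw *; rewrite -/(pt b t) in sw *.
    have Gk0 : 0 < normc (G (pt b t)) ^+ k.
      by rewrite exprn_gt0 // (lt_le_trans ltr01) // G1.
    rewrite /q normcM normcV normcX ler_pdivrMr //.
    (* Where [f] is large the point is covered and [G] is at least [M] in modulus, which absorbs
       [M ^+ k]; elsewhere the modulus of [G] is still at least 1. *)
    have [ft|ft] := leP (tau ^+ k) (normc (f (pt b t))).
      apply: (@le_trans _ _ (1 * M ^+ k)); first by rewrite mul1r; exact: gM.
      apply: ler_pM => //; [by rewrite exprn_ge0 // ltW|by rewrite exprn_ege1 // ltW|].
      by rewrite ler_pXn2r ?nnegrE ?normc_ge0 ?(ltW M0) //; exact: GM.
    apply: (@le_trans _ _ (tau ^+ k * 1)); first by rewrite mulr1 ltW.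
    by rewrite ler_wpM2l ?exprn_ge0 ?(ltW tau0) // exprn_ege1 // G1.
move=> w sw; have sw' : square s w.
  case: sw => w1 w2; split; [apply: le_trans w1 _|apply: le_trans w2 _];
    by rewrite ler_pdivrMr // mulr_natr mulr2n lerDl ltW.
have Gn0 : G w != 0 by rewrite -normc_gt0; exact: lt_le_trans ltr01 (G1 w sw').
have -> : f w = q w * G w ^+ k by rewrite /q divfK // expf_neq0.
rewrite normcM normcX exprMn; apply: ler_pM; rewrite ?exprn_ge0 ?normc_ge0 //.
  exact: qb.
by rewrite ler_pXn2r ?nnegrE ?normc_ge0 ?(ltW tau0) //; exact: Gle.
Qed.

End HartogsLemma.

(** * Extension of bounds *)

Section Extension.
Variable R : realType.
Notation C := R[i].

Lemma expr_unbounded (a c : R) : 1 < a -> exists N, forall k, (N <= k)%N -> c <= a ^+ k.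
Proof.
move=> a1; have a10 : 0 < a - 1 by rewrite subr_gt0.
have bern k : 1 + (a - 1) *+ k <= a ^+ k.
  elim: k => [|k IH]; first by rewrite mulr0n addr0.
  rewrite exprS mulrSr; apply: (@le_trans _ _ (a * (1 + (a - 1) *+ k))); last first.
    by rewrite ler_pM2l // (lt_trans ltr01).
  have : 0 <= (a - 1) * ((a - 1) *+ k) by rewrite mulr_ge0 ?mulrn_wge0 ?ltW.
  move: ((a - 1) *+ k) => u; lra.
exists (Num.truncn (c / (a - 1))).+1 => k Nk.
apply: le_trans (bern k).
have : c / (a - 1) < k%:R by apply: lt_le_trans (truncnS_gt _) _; rewrite ler_nat.
by rewrite ltr_pdivrMr // mulr_natl => /ltW ck; apply: le_trans ck _; rewrite lerDr.
Qed.

Lemma sum_geometric_le (a : R) k : 0 <= a -> a < 1 -> \sum_(i < k) a ^+ i <= (1 - a)^-1.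
Proof.
move=> a0 a1; have a10 : 0 < 1 - a by rewrite subr_gt0.
rewrite -(ler_pM2l a10) mulfV ?gt_eqF //.
have := subrX1 a k; have : 0 <= a ^+ k by rewrite exprn_ge0.
move: (\sum_(i < k) _) (a ^+ k) => u v v0 E; lra.
Qed.

(** The Newton coefficients in [z] are holomorphic in [w]. Boundedness for [z] in the small disc
    gives them a uniform but fast geometric growth; for each [w], the large disc gives a slower
    growth with a constant depending on [w]. Hartogs' lemma makes the slower growth uniform, and the
    Newton series then converges in a disc proportional to [rho]. *)
Theorem hartogs_extension (X : Type) (f : X -> C -> C -> C) (eps rho s M : R) :
  0 < eps -> eps <= rho -> 0 < s ->
  (forall x w, square s w -> holon (disc rho) (fun z => f x z w)) ->
  (forall x z, disc eps z -> holon (square s) (f x z)) ->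
  (forall x z w, disc eps z -> square s w -> normc (f x z w) <= M) ->
  (forall w, square s w -> exists c : R, forall x z, disc rho z -> normc (f x z w) <= c) ->
  exists M' : R, forall x z w, disc (rho / 8) z -> square (s / 2) w ->
    normc (f x z w) <= M'.
Proof.
move=> eps0 epsrho s0 fz fw fM fc.
have rho0 : 0 < rho by exact: lt_le_trans epsrho.
pose del := eps / 8.
have del0 : 0 < del by rewrite divr_gt0.
have deleps : del < eps by rewrite /del; lra.
have delrho : del <= rho / 8 by rewrite /del; lra.
(* Distinct nodes of modulus at most [rho / 8]: for [z] in the final disc, each factor [z - nd j] is
   at most [rho / 4] in modulus. *)
pose nd (j : nat) : C := (del / j.+1%:R)%:C.
have ndI : injective nd.
  move=> i j /complexI /(mulfI (lt0r_neq0 del0)) /invr_inj /eqP.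
  by rewrite eqr_nat => /eqP [].
have ndd j : normc (nd j) <= del.
  have e0 : 0 <= del / j.+1%:R by rewrite divr_ge0 // ltW.
  rewrite /nd normc_real ger0_norm // ler_pdivrMr ?ltr0Sn //.
  by rewrite ler_peMr ?(ltW del0) // ler1n.
have nde j : disc eps (nd j) by apply: le_trans (ndd j) (ltW deleps).
pose c x k w := divdiff (fun z => f x z w) nd k (nd k).
pose p := 2 / (eps - del); pose q := 2 / (rho - del).
have p0 : 0 < p by rewrite divr_gt0 // subr_gt0.
have delrho' : del < rho by apply: lt_le_trans epsrho.
have q0 : 0 < q by rewrite divr_gt0 // subr_gt0.
have fzeps x w : square s w -> holon (disc eps) (fun z => f x z w).
  by move=> sw; apply: holonS (fz x w sw) => z /le_trans; exact.
have cM x k w : square s w -> normc (c x k w) <= M * p ^+ k.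
  move=> sw.
  have [_ _ H] := divdiffP k ndI ndd deleps (fzeps x w sw) (fun z zd => fM x z w zd sw).
  exact: H.
have cC w : square s w -> exists2 b : R, 0 <= b & forall x k z, disc rho z ->
    normc (divdiff (fun z => f x z w) nd k z) <= b * q ^+ k.
  move=> sw; have [b Hb] := fc w sw.
  exists (Num.max 0 b) => [|x k z zd]; first by rewrite le_max lexx.
  have Hb' z' : disc rho z' -> normc (f x z' w) <= Num.max 0 b.
    by move=> /Hb H; rewrite le_max H orbT.
  by have [_ _ H] := divdiffP k ndI ndd delrho' (fz x w sw) Hb'; exact: H.
have ch x k : holon (square s) (c x k).
  apply: (@divdiff_holon _ _ (disc eps)) => //; last exact: fw.
  apply/mapP => -[j]; rewrite mem_iota add0n => /andP[_ jk] /ndI kj.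
  by rewrite kj ltnn in jk.
(* One power of [a] absorbs the constant depending on [w], two more are lost in Hartogs' lemma, and
   [a ^+ 3 * (4 / 7)] is still below 1. *)
pose a : R := 9 / 8.
have a1 : 1 < a by rewrite /a; lra.
have a0 : 0 < a by exact: lt_trans a1.
pose g x k w := ((q * a) ^- k)%:C * c x k w.
have gE x k w : normc (g x k w) = normc (c x k w) / (q * a) ^+ k.
  rewrite normcM normc_real ger0_norm; first by rewrite mulrC.
  by rewrite invr_ge0 exprn_ge0 // mulr_ge0 // ltW.
(* Both factors are at least 1, so that for positive [k] the power [B ^+ k] dominates the single
   constant [M] times the ratio to the power [k]. *)
pose B := Num.max 1 M * Num.max 1 (p / (q * a)).
have qa0 : 0 < q * a by rewrite mulr_gt0.
have B1 : 1 <= B by rewrite mulr_ege1 // le_max lexx.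
have [|||N HN] := @hartogs_lemma _ X g s B a s0 B1 a1.
- by move=> x k; apply: holonM; [exact: holon_cst|exact: ch].
- move=> x k w k0 sw; rewrite gE ler_pdivrMr ?exprn_gt0 //.
  apply: le_trans (cM x k w sw) _.
  rewrite /B [(Num.max 1 M * _) ^+ k]exprMn -[X in _ <= X]mulrA; apply: ler_pM.
  + by apply: le_trans (fM x _ _ (nde 0%N) sw); exact: normc_ge0.
  + by rewrite exprn_ge0 // ltW.
  + apply: (@le_trans _ _ (Num.max 1 M)); first by rewrite le_max lexx orbT.
    by apply: ler_eXnr => //; rewrite le_max lexx.
  + rewrite -exprMn ler_pXn2r ?nnegrE ?(ltW p0) //.
      by rewrite -ler_pdivrMr // le_max lexx orbT.
    by rewrite mulr_ge0 ?(ltW qa0) // le_max ler01.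
- move=> w sw; have [b b0 Hb] := cC w sw.
  have [N HN] := expr_unbounded b a1; exists N => k Nk x.
  rewrite gE ler_pdivrMr ?exprn_gt0 // mul1r exprMn mulrC.
  have := Hb x k (nd k) (le_trans (ndd k) (ltW delrho')) => /le_trans; apply.
  by rewrite ler_wpM2r ?exprn_ge0 ?(ltW q0) // HN.
(* 729 / 896 = a ^ 3 * (4 / 7), and 4 / 7 bounds q * (rho / 4). *)
pose kap : R := 729 / 896.
(* The first [N] terms are bounded crudely, the following ones by a geometric series, and the
   remainder of the Newton expansion by 1. *)
exists (\sum_(i < N) M * (p * (rho / 4)) ^+ i + (1 - kap)^-1 + 1).
move=> x z w zd sw2.
have sw : square s w.
  case: sw2 => w1 w2; split; [apply: le_trans w1 _|apply: le_trans w2 _]; lra.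
have [b b0 Hb] := cC w sw.
have q4 : q * (rho / 4) <= 4 / 7.
  rewrite /q mulrAC ler_pdivrMr ?subr_gt0 //; lra.
have q40 : 0 <= q * (rho / 4) by rewrite mulr_ge0 ?(ltW q0) // divr_ge0 // ltW.
have qn k : (q * (rho / 4)) ^+ k <= (4 / 7) ^+ k.
  by apply: lerXn2r; rewrite ?nnegrE ?divr_ge0.
(* The length [N + K] of the expansion depends on [w] through [b], but the final bound does not: [K]
   only makes the remainder [b * (4 / 7) ^+ (N + K)] at most 1. *)
have [K HK] := @expr_unbounded (7 / 4) b ltac:(lra).
have zs k : normc (\prod_(j < k) (z - nd j)) <= (rho / 4) ^+ k.
  rewrite normc_prod; apply: (@le_trans _ _ (\prod_(j < k) (rho / 4))); last first.
    by rewrite prodr_const card_ord.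
  apply: ler_prod => j _; rewrite normc_ge0 /=.
  apply: le_trans (le_normcB _ _) _; have := ndd j.
  move: zd delrho; rewrite /disc /=; lra.
rewrite (newton_expansion (fun z => f x z w) nd (N + K) z).
apply: le_trans (le_normcD _ _) _; apply: lerD; last first.
  rewrite normcM; apply: (@le_trans _ _ (b * q ^+ (N + K) * (rho / 4) ^+ (N + K))).
    apply: ler_pM; rewrite ?normc_ge0 //; apply: Hb.
    by apply: le_trans zd _; lra.
  rewrite -mulrA -exprMn; apply: (@le_trans _ _ (b * (4 / 7) ^+ (N + K))).
    by rewrite ler_wpM2l.
  have E1 : 1 = (7 / 4) ^+ (N + K) * (4 / 7) ^+ (N + K) :> R.
    rewrite -exprMn; have -> : 7 / 4 * (4 / 7) = 1 :> R by lra.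
    by rewrite expr1n.
  rewrite [leRHS]E1 ler_wpM2r ?HK ?leq_addl // exprn_ge0 //; lra.
apply: (@le_trans _ _ (\sum_(i < N + K) normc (c x i w) * (rho / 4) ^+ i)).
  elim: (N + K)%N => [|k IH]; first by rewrite !big_ord0 normc0 lexx.
  rewrite !big_ord_recr /=; apply: le_trans (le_normcD _ _) _; apply: lerD => //.
  by rewrite normcM; apply: ler_wpM2l; [exact: normc_ge0|exact: zs].
rewrite big_split_ord /=; apply: lerD.
  apply: ler_sum => i _; rewrite [(p * _) ^+ _]exprMn [leRHS]mulrA ler_wpM2r ?exprn_ge0 ?divr_ge0 ?(ltW rho0) //.
  exact: cM.
apply: (@le_trans _ _ (\sum_(i < K) kap ^+ i)); last by apply: sum_geometric_le; rewrite /kap; lra.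
apply: ler_sum => i _.
have gi := HN (N + i)%N (leq_addr _ _) x w sw2.
move: gi; rewrite gE ler_pdivrMr ?exprn_gt0 // -exprMn => gi.
have r40 : 0 <= rho / 4 by rewrite divr_ge0 // ltW.
apply: (@le_trans _ _ ((a * a * (q * a)) ^+ (N + i) * (rho / 4) ^+ (N + i))).
  by rewrite ler_wpM2r ?exprn_ge0.
rewrite -exprMn; apply: (@le_trans _ _ (kap ^+ (N + i))).
  apply: lerXn2r; rewrite ?nnegrE.
  - by apply: mulr_ge0 => //; apply: mulr_ge0; [rewrite mulr_ge0 ?(ltW a0)|exact: ltW].
  - by rewrite /kap; lra.
  - have -> : a * a * (q * a) * (rho / 4) = a ^+ 3 * (q * (rho / 4)) by ring.
    apply: (@le_trans _ _ (a ^+ 3 * (4 / 7))); first by rewrite ler_wpM2l // exprn_ge0 // ltW.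
    by rewrite /a /kap; lra.
by apply: ler_wiXn2l; rewrite ?leq_addl // /kap; lra.
Qed.

End Extension.

(** * Separately holomorphic functions *)

Section Several.
Variables (R : realType) (n : nat).
Notation C := R[i].
Notation V := 'rV[R[i]]_n.
Implicit Types (a b z : V) (D : set V) (g : V -> C).

Definition box a (r : R) : set V := [set z | forall j, normc (z 0 j - a 0 j) < r].
Definition cbox a (r : R) : set V := [set z | forall j, normc (z 0 j - a 0 j) <= r].

Lemma nbhs_boxP a (A : set V) :
  nbhs a A <-> exists2 r : R, 0 < r & box a r `<=` A.
Proof.
split=> [/nbhs_ballP[e /= e0 eA]|[r r0 rA]].
  have eE : e = (complex.Re e)%:C by rewrite RRe_real // gtr0_real.
  exists (complex.Re e); first by rewrite -ltcR -eE.
  move=> z zr; apply: eA; split => // i j; rewrite (ord1 i).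
  by rewrite -ball_normE /ball_ /= distrC norm_normc eE ltcR.
apply/nbhs_ballP; exists r%:C => /=; first by rewrite ltcR.
move=> z [_ zr]; apply: rA => j; have := zr 0 j.
by rewrite -ball_normE /ball_ /= distrC norm_normc ltcR.
Qed.

Lemma box_cbox a r : box a r `<=` cbox a r.
Proof. by move=> z zr j; exact: ltW. Qed.

Lemma cbox_box a r r' : r < r' -> cbox a r `<=` box a r'.
Proof. by move=> rr z zr j; exact: le_lt_trans (zr j) rr. Qed.

Lemma cboxS a r r' : r <= r' -> cbox a r `<=` cbox a r'.
Proof. by move=> rr z zr j; exact: le_trans (zr j) rr. Qed.

Lemma cbox_center a r : 0 <= r -> cbox a r a.
Proof. by move=> r0 j; rewrite subrr normc0. Qed.

Lemma cbox_trans a b z r r' : cbox a r b -> cbox b r' z -> cbox a (r + r') z.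
Proof.
move=> ab bz j; have := le_normcD (z 0 j - b 0 j) (b 0 j - a 0 j).
rewrite addrA subrK => /le_trans; apply; rewrite addrC; exact: lerD.
Qed.

Lemma open_cbox D a : open D -> D a -> exists2 r : R, 0 < r & cbox a r `<=` D.
Proof.
move=> oD Da; have /nbhs_boxP[r r0 rD] := open_nbhs_nbhs (conj oD Da).
exists (r / 2); first by rewrite divr_gt0.
by apply: subset_trans rD; apply: cbox_box; lra.
Qed.

Lemma compact_cbox a r : compact (cbox a r).
Proof.
apply: (@rV_compact _ n (fun j => [set w : C | normc (w - a 0 j) <= r])) => j.
have -> : [set w : C | normc (w - a 0 j) <= r] = (fun z : C => a 0 j + z) @` disc r.
  apply/seteqP; split=> [w wr|w [z zr <-]] /=; last by rewrite addrC addKr.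
  by exists (w - a 0 j) => //; rewrite addrC subrK.
apply: continuous_compact (@compact_disc _ r).
apply: continuous_within => z _.
by apply: (@continuousD _ _ _ (fun=> a 0 j) id z); [exact: cst_continuous|exact: cvg_id].
Qed.

Definition setc a (j : 'I_n) (w : C) : V := \row_k (if k == j then w else a 0 k).

Lemma setcE a j w k : setc a j w 0 k = if k == j then w else a 0 k.
Proof. by rewrite mxE. Qed.

Lemma setc_id a j : setc a j (a 0 j) = a.
Proof. by apply/rowP => k; rewrite setcE; case: eqP => [->|]. Qed.

Definition sephol D g := forall a j, holon [set w | D (setc a j w)] (fun w => g (setc a j w)).

Definition locbdd g a := exists r M : R, 0 < r /\ forall z, cbox a r z -> normc (g z) <= M.

(** Both estimates bound the difference quotient at the node 0, whose value at 0 is the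
    derivative. *)
Lemma cauchy_estimate (f : C -> C) (r M : R) : 0 < r -> holon (disc r) f ->
  (forall z : C, disc r z -> normc (f z) <= M) ->
  (forall z : C, disc r z -> normc (f z - f 0) <= M * (2 / r) * normc z) /\
  (forall l : C, is_derive (0 : C) 1 f l -> normc l <= M * (2 / r)).
Proof.
move=> r0 Hf fM.
have d0 : disc r 0 by rewrite /disc /mkset normc0 ltW.
have key (l : C) : is_derive (0 : C) 1 f l ->
    forall z : C, disc r z -> normc (diffq f 0 l z) <= M * (2 / r).
  move=> df z zr; have := @diffq_bound _ f [::] 0 l r 0 M _ r0 df _ _ fM z zr.
  rewrite subr0; apply; first by rewrite normc0.
    by move=> z' zr'; exact: holon_continuous Hf zr'.
  by apply: holonS Hf => z' [].
split=> [z zr|l df]; last by have := key l df 0 d0; rewrite /diffq eqxx.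
have [f' H] := Hf; have [df _] := H 0 d0.
rewrite (diffqE f 0 (f' 0)) subr0 normcM ler_wpM2r ?normc_ge0 //.
exact: key.
Qed.

Lemma sephol_coord D g a b j r : sephol D g -> cbox a (r + r) `<=` D -> cbox a r b ->
  holon (disc r) (fun w => g (setc b j (b 0 j + w))) /\
  forall w, disc r w -> cbox a (r + r) (setc b j (b 0 j + w)).
Proof.
move=> sg aD ab.
have H w : disc r w -> cbox a (r + r) (setc b j (b 0 j + w)).
  move=> wr; apply: cbox_trans ab _ => k; rewrite setcE.
  case: eqP => [->|_]; first by rewrite addrC addKr.
  by rewrite subrr normc0; apply: le_trans wr; exact: normc_ge0.
split=> //; have := holon_shift (b 0 j) (sg b j).
by apply: holonS => w wr /=; apply: aD; exact: H.
Qed.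

(** The coordinates of [b] are replaced by those of [z] one at a time. Every intermediate point lies
    in [cbox a r], so a disc of radius [r] is available in each variable for the Cauchy estimate. *)
Lemma osgood_lipschitz D g a r M : 0 < r -> sephol D g -> cbox a (r + r) `<=` D ->
  (forall z, cbox a (r + r) z -> normc (g z) <= M) ->
  forall b z d, cbox a r b -> cbox a r z -> cbox b d z -> d <= r ->
  normc (g z - g b) <= M * (2 / r) * d *+ n.
Proof.
move=> r0 sg aD gM b z d ab az bz dr.
pose y (k : nat) : V := \row_j (if (j < k)%N then z 0 j else b 0 j).
have ay k : cbox a r (y k) by move=> j; rewrite mxE; case: ifP.
have y0 : y 0%N = b by apply/rowP => j; rewrite mxE.
have yn : y n = z by apply/rowP => j; rewrite mxE ltn_ord.
have M0 : 0 <= M.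
  apply: le_trans (gM a _); first exact: normc_ge0.
  by apply: cbox_center; rewrite addr_ge0 ?ltW.
have step (k : nat) : (k < n)%N -> normc (g (y k.+1) - g (y k)) <= M * (2 / r) * d.
  move=> kn; pose j := Ordinal kn.
  have [h1 h2] := sephol_coord j sg aD (ay k).
  have [H _] := cauchy_estimate r0 h1 (fun w wr => gM _ (h2 w wr)).
  have zb : normc (z 0 j - b 0 j) <= d by exact: bz.
  have := H (z 0 j - b 0 j) (le_trans zb dr).
  have -> : y k 0 j = b 0 j by rewrite mxE ltnn.
  have -> : setc (y k) j (b 0 j + (z 0 j - b 0 j)) = y k.+1.
    apply/rowP => i; rewrite setcE !mxE [(i < k.+1)%N]ltnS [(i <= k)%N]leq_eqVlt.
    have -> : (i == j) = (i == k :> nat) by [].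
    case: eqP => [ik|_] //=; rewrite addrC subrK; congr (z 0 _); exact/val_inj.
  have -> : setc (y k) j (b 0 j + 0) = y k.
    by rewrite addr0 -[in RHS](setc_id (y k) j) mxE ltnn.
  move/le_trans; apply; rewrite ler_wpM2l // mulr_ge0 // divr_ge0 // ltW //.
rewrite -yn -y0.
have : forall k, (k <= n)%N -> normc (g (y k) - g (y 0%N)) <= M * (2 / r) * d *+ k.
  elim=> [|k IH] kn; first by rewrite subrr normc0 mulr0n.
  have := le_normcD (g (y k.+1) - g (y k)) (g (y k) - g (y 0%N)).
  rewrite addrA subrK mulrS => /le_trans; apply.
  by apply: lerD; [exact: step|exact: IH (ltnW kn)].
by apply.
Qed.

Lemma locbdd_box D g a : open D -> D a -> locbdd g a ->
  exists r M : R, [/\ 0 < r, cbox a (r + r) `<=` D &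
    forall z, cbox a (r + r) z -> normc (g z) <= M].
Proof.
move=> oD Da [r1 [M [r10 gM]]]; have [r2 r20 r2D] := open_cbox oD Da.
exists (Num.min r1 r2 / 2), M; rewrite -splitr; split.
- by rewrite divr_gt0 // lt_min r10.
- by apply: subset_trans r2D; apply: cboxS; rewrite ge_min lexx orbT.
- by move=> z zr; apply: gM; apply: cboxS zr; rewrite ge_min lexx.
Qed.

Lemma lipschitz_bound (L e : R) : 0 <= L -> 0 < e -> exists2 d : R, 0 < d & L * d *+ n < e.
Proof.
move=> L0 e0; have k0 : 0 < L *+ n + 1 by rewrite ltr_wpDl // mulrn_wge0.
exists (e / (L *+ n + 1)); first by rewrite divr_gt0.
by rewrite -mulrnAl mulrA ltr_pdivrMr // mulrC ltr_pM2l // ltrDl.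
Qed.

Lemma sephol_continuous D g a : open D -> sephol D g -> D a -> locbdd g a ->
  {for a, continuous g}.
Proof.
move=> oD sg Da /(locbdd_box oD Da)[r [M [r0 aD gM]]].
have M0 : 0 <= M.
  apply: le_trans (gM a _); first exact: normc_ge0.
  by apply: cbox_center; rewrite addr_ge0 ?ltW.
move=> A /nbhsCP[e e0 eA]; apply/nbhs_boxP.
have L0 : 0 <= M * (2 / r) by rewrite mulr_ge0 // divr_ge0 // ltW.
have [d d0 Hd] := lipschitz_bound L0 e0.
exists (Num.min r d); first by rewrite lt_min r0.
move=> z zr; apply: eA; apply: le_lt_trans Hd.
have ca : cbox a r a by apply: cbox_center; exact: ltW.
have cz : cbox a (Num.min r d) z by exact: box_cbox.
apply: le_trans (osgood_lipschitz r0 sg aD gM ca _ cz _) _.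
- by apply: cboxS cz; rewrite ge_min lexx.
- by rewrite ge_min lexx.
- by rewrite lerMn2r ler_wpM2l ?orbT // ge_min lexx orbT.
Qed.

Lemma sephol_bounded D g c r : open D -> sephol D g -> 0 <= r -> cbox c r `<=` D ->
  (forall z, cbox c r z -> locbdd g z) ->
  exists M : R, forall z, cbox c r z -> normc (g z) <= M.
Proof.
move=> oD sg r0 cD lb.
have K0 : cbox c r !=set0 by exists c; exact: cbox_center.
have cF : {within cbox c r, continuous (fun z => normc (g z))}.
  apply: continuous_within => z zr.
  have cz := sephol_continuous oD sg (cD z zr) (lb z zr).
  exact: (cvg_comp _ (@normc R) cz (@normc_continuous R _)).
have [m _ Hm] := compact_EVT_max K0 (@compact_cbox c r) cF.
by exists (normc (g m)) => z zr; apply: Hm; apply/mem_set.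
Qed.

Definition pderiv g (t : 'I_n) a : C := 'D_1 (fun w => g (setc a t w)) (a 0 t).

Lemma sephol_pderiv D g t a : sephol D g -> D a ->
  is_derive (a 0 t) 1 (fun w => g (setc a t w)) (pderiv g t a).
Proof.
move=> sg Da; have [f' H] := sg a t.
have [|[df _] _] := H (a 0 t); first by rewrite /= setc_id.
exact: DeriveDef.
Qed.

(** The slices through [a] and a nearby [b], both recentred at 0, differ little on a disc by
    [osgood_lipschitz]; the Cauchy estimate applied to their difference compares the derivatives at
    0. *)
Lemma pderiv_continuous D g t a : open D -> sephol D g -> D a -> locbdd g a ->
  {for a, continuous (pderiv g t)}.
Proof.
move=> oD sg Da /(locbdd_box oD Da)[r [M [r0 aD gM]]].
have M0 : 0 <= M.
  apply: le_trans (gM a _); first exact: normc_ge0.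
  by apply: cbox_center; rewrite addr_ge0 ?ltW.
pose s := r / 2.
have s0 : 0 < s by rewrite divr_gt0.
have L0 : 0 <= M * (2 / r) by rewrite mulr_ge0 // divr_ge0 // ltW.
have L20 : 0 <= M * (2 / r) * (2 / s) by rewrite mulr_ge0 // divr_ge0 // ltW.
have sD : cbox a (s + s) `<=` D by apply: subset_trans aD; apply: cboxS; rewrite /s; lra.
move=> A /nbhsCP[e e0 eA]; apply/nbhs_boxP.
have [d d0 Hd] := lipschitz_bound L20 e0.
exists (Num.min s d); first by rewrite lt_min s0.
move=> b bs; apply: eA; apply: le_lt_trans Hd.
have cb : cbox a (Num.min s d) b by exact: box_cbox.
have cbs : cbox a s b by apply: cboxS cb; rewrite ge_min lexx.
have cas : cbox a s a by apply: cbox_center; exact: ltW.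
have [hb1 hb2] := sephol_coord t sg sD cbs.
have [ha1 ha2] := sephol_coord t sg sD cas.
have dsh (x : V) : D x ->
    is_derive (0 : C) 1 (fun w => g (setc x t (x 0 t + w))) (pderiv g t x).
  move=> Dx; have dx := sephol_pderiv t sg Dx.
  apply/is_deriveCP => e' e'0; have [d' d'0 H] := (is_deriveCP _ _ _).1 dx e' e'0.
  by exists d' => // w; have := H (x 0 t + w); rewrite subr0 addr0 (addrC (x 0 t)) addrK.
have Db : D b by apply: sD; apply: cboxS cbs; lra.
have dd := is_deriveB (dsh b Db) (dsh a Da).
have hh : holon (disc s) (fun w => g (setc b t (b 0 t + w)) - g (setc a t (a 0 t + w))).
  exact: holonB.
have s2 : s + s = r by rewrite /s -splitr.
have bound w : disc s w ->
    normc (g (setc b t (b 0 t + w)) - g (setc a t (a 0 t + w))) <= M * (2 / r) * d *+ n.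
  move=> ws.
  apply: le_trans (osgood_lipschitz (d := Num.min s d) r0 sg aD gM _ _ _ _) _.
  - by rewrite -s2; exact: ha2.
  - by rewrite -s2; exact: hb2.
  - move=> k; rewrite !setcE; case: eqP => [_|_]; last exact: cb.
    by rewrite opprD addrACA subrr addr0; exact: cb.
  - by rewrite ge_min /s; apply/orP; left; lra.
  - by rewrite lerMn2r ler_wpM2l ?orbT // ge_min lexx orbT.
have [_ H] := cauchy_estimate s0 hh bound.
apply: le_trans (H _ dd) _; rewrite le_eqVlt; apply/orP; left; apply/eqP.
by rewrite mulrnAl; congr (_ *+ _); ring.
Qed.

End Several.

(** * Baire's argument on closed polydiscs *)

Section Baire.
Variables (R : realType) (n : nat).
Notation C := R[i].
Notation V := 'rV[R[i]]_n.

(** If no [E M] contained a box, nested closed boxes could be chosen, the successive ones avoiding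
    [E 0], [E 1] and so on; by compactness they share a point, which lies in no [E M]. *)
Lemma baire_cbox (a : V) (r : R) (E : nat -> set V) : 0 < r ->
  (forall M z, cbox a r z -> ~ E M z ->
     exists2 e : R, 0 < e & forall z', cbox z e z' -> ~ E M z') ->
  (forall z, cbox a r z -> exists M, E M z) ->
  exists M c e, [/\ 0 < e, cbox c e `<=` cbox a r & cbox c e `<=` E M].
Proof.
move=> r0 oE cE; apply: contrapT => nE.
pose ok (p : V * R) := 0 < p.2 /\ cbox p.1 p.2 `<=` cbox a r.
have step (Mp : nat * {p | ok p}) : exists q : {p | ok p},
    cbox (sval q).1 (sval q).2 `<=` cbox (sval Mp.2).1 (sval Mp.2).2 /\
    forall z, cbox (sval q).1 (sval q).2 z -> ~ E Mp.1 z.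
  case: Mp => M [[c e] [/= e0 ca]].
  have e20 : 0 < e / 2 by rewrite divr_gt0.
  (* Halving the radius leaves room for a box around [z] inside the current one. *)
  have [z cz nz] : exists2 z, cbox c (e / 2) z & ~ E M z.
    apply: contrapT => nz; apply: nE; exists M, c, (e / 2); split => //.
      by apply: subset_trans ca; apply: cboxS; lra.
    by move=> z cz; apply: contrapT => nEz; apply: nz; exists z.
  have az : cbox a r z by apply: ca; apply: cboxS cz; lra.
  have [d d0 dE] := oE M z az nz.
  have sub : cbox z (Num.min (e / 2) d) `<=` cbox c e.
    move=> y yz; have := cbox_trans cz yz; apply: cboxS.
    by rewrite [leRHS]splitr lerD2l ge_min lexx.
  have okq : ok (z, Num.min (e / 2) d).
    by split => /=; [rewrite lt_min e20|exact: subset_trans ca].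
  exists (exist _ _ okq); split => //= y yz; apply: dE; apply: cboxS yz.
  by rewrite ge_min lexx orbT.
have [F HF] := choice step.
have ok0 : ok (a, r) by split.
pose s := fix s M := if M is M'.+1 then F (M', s M') else exist ok _ ok0.
pose B M := cbox (sval (s M)).1 (sval (s M)).2.
have BS M : B M.+1 `<=` B M by exact: (HF (M, s M)).1.
have BE M z : B M.+1 z -> ~ E M z by exact: (HF (M, s M)).2.
have Ble M M' : (M <= M')%N -> B M' `<=` B M.
  elim: M' => [|M' IH]; first by rewrite leqn0 => /eqP ->.
  rewrite leq_eqVlt => /orP[/eqP -> //|]; rewrite ltnS => /IH; exact: subset_trans.
pose x M := (sval (s M)).1.
have xB M : B M (x M) by apply: cbox_center; apply: ltW; case: (svalP (s M)).
have [p [ap clp]] : cbox a r `&` cluster (x @ \oo) !=set0.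
  apply: (@compact_cbox R n a r); exists 0%N => // M _.
  exact: (Ble 0%N M (leq0n _) _ (xB M)).
have pB M : B M p.
  move=> j; apply/ler_addgt0Pr => e e0.
  have [y [By py]] : B M `&` box p e !=set0.
    apply: clp; last by apply/nbhs_boxP; exists e.
    by exists M => // M' /= MM'; exact: Ble (xB M').
  have := le_normcD (p 0 j - y 0 j) (y 0 j - (sval (s M)).1 0 j).
  rewrite addrA subrK => /le_trans; apply; rewrite [leRHS]addrC.
  apply: lerD; last exact: By.
  by rewrite normcB; apply: ltW; exact: py.
have [M EM] := cE p ap.
exact: (BE M p (pB M.+1)).
Qed.

End Baire.

(** * Local boundedness, by induction on the number of variables *)

Section Induction.
Variables (R : realType) (n : nat).
Notation C := R[i].
Notation V := 'rV[R[i]]_n.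
Implicit Types (a b z : V) (D : set V) (g : V -> C).

(** The composite [g \o proj k a] is [g] as a function of its first [k] variables, the others being
    frozen at [a]. The induction on [k] thus stays in the single space [V]. *)
Definition proj (k : nat) a z : V := \row_j (if (j < k)%N then z 0 j else a 0 j).

Lemma projE k a z j : proj k a z 0 j = if (j < k)%N then z 0 j else a 0 j.
Proof. by rewrite mxE. Qed.

Lemma proj_setc k a z j w : proj k a (setc z j w) =
  if (j < k)%N then setc (proj k a z) j w else proj k a z.
Proof.
apply/rowP => i; case: ifP => jk; rewrite !(projE, setcE).
  by case: eqP => [->|]; rewrite ?jk.
by case: eqP => [->|]; rewrite ?jk.
Qed.

Lemma sephol_proj D g k a : sephol D g -> sephol (proj k a @^-1` D) (g \o proj k a).
Proof.
move=> sg b j; have E w := proj_setc k a b j w.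
case: (j < k)%N E => E.
  apply: (@eq_holon _ _ (fun w => g (setc (proj k a b) j w))).
    by move=> w /=; rewrite E.
  by apply: holonS (sg (proj k a b) j) => w; rewrite /= E.
apply: (@eq_holon _ _ (fun=> g (proj k a b))); last exact: holon_cst.
by move=> w /=; rewrite E.
Qed.

Lemma cbox_proj k a z z' r : 0 <= r -> cbox z r z' -> cbox (proj k a z) r (proj k a z').
Proof.
move=> r0 zz j; rewrite !projE; case: ifP => // _.
by rewrite subrr normc0.
Qed.

Lemma open_proj D k a : open D -> open (proj k a @^-1` D).
Proof.
rewrite !openE => oD z /= Dz.
have /nbhs_boxP[r r0 rD] := oD _ Dz.
apply/nbhs_boxP; exists r => // z' zz' /=; apply: rD => j; rewrite !projE.
by case: ifP => // _; rewrite subrr normc0.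
Qed.

Lemma proj_proj k a z z' : proj k (proj k a z) z' = proj k a z'.
Proof. by apply/rowP => j; rewrite !projE; case: (j < k)%N. Qed.

Lemma locbdd_proj D g k a z :
  (forall b, D b -> locbdd (g \o proj k b) b) -> D (proj k a z) ->
  locbdd (g \o proj k a) z.
Proof.
move=> Pk /Pk[r [M [r0 H]]]; exists r, M; split => // z' zz'.
have := H _ (cbox_proj k a (ltW r0) zz'); rewrite /= !proj_proj.
have -> : proj k a (proj k a z') = proj k a z'.
  by apply/rowP => j; rewrite !projE; case: (j < k)%N.
by [].
Qed.

Section Step.
Variables (D : set V) (g : V -> C) (k : nat) (kn : (k < n)%N).
Hypotheses (oD : open D) (sg : sephol D g)
  (Pk : forall a, D a -> locbdd (g \o proj k a) a).
Variables (a : V) (r : R).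
Hypotheses (r0 : 0 < r) (aD : cbox a r `<=` D).
Let j := Ordinal kn.

Let jk (i : 'I_n) : (i == j) = (i == k :> nat). Proof. by []. Qed.

Lemma setc_proj z w : setc (proj k a z) j w = proj k (setc a j w) z.
Proof.
apply/rowP => i; rewrite !(projE, setcE) jk.
by case: eqP => // ->; rewrite ltnn.
Qed.

Lemma slice_in z w : (forall i : 'I_n, (i < k)%N -> normc (z 0 i - a 0 i) <= r) ->
  normc w <= r -> D (proj k (setc a j (a 0 j + w)) z).
Proof.
move=> zr wr; apply: aD => i; rewrite projE setcE jk.
case: ifP => ik; first exact: zr.
case: eqP => [ij|_]; last by rewrite subrr normc0 ltW.
have -> : i = j by apply: val_inj.
by rewrite addrC addKr.
Qed.

(** Baire's argument for the sets where [g] is bounded by [M] on the whole disc of the variable [j].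
    They are relatively closed because [g] is continuous in the first [k] variables, by the
    induction hypothesis, and they exhaust the box because [g] is continuous in the variable [j]. *)
Lemma bounded_start : exists M c e,
  [/\ 0 < e, cbox c e `<=` cbox a (r / 32) &
      forall z w, cbox c e z -> normc w <= r ->
        normc (g (proj k (setc a j (a 0 j + w)) z)) <= M].
Proof.
pose E (M : nat) : set V := [set z | forall w, normc w <= r ->
  normc (g (proj k (setc a j (a 0 j + w)) z)) <= M%:R].
have r32 : 0 < r / 32 by rewrite divr_gt0.
have sub z : cbox a (r / 32) z -> forall i : 'I_n, (i < k)%N -> normc (z 0 i - a 0 i) <= r.
  by move=> za i _; apply: le_trans (za i) _; lra.
have [|z za|M [c [e [e0 ce cE]]]] := @baire_cbox _ _ a (r / 32) E r32.
- move=> M z za nE.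
  have [w [wr wM]] : exists w, normc w <= r /\
      M%:R < normc (g (proj k (setc a j (a 0 j + w)) z)).
    apply: contrapT => H; apply: nE => w wr; rewrite leNgt; apply/negP => wM.
    by apply: H; exists w.
  set a' := setc a j (a 0 j + w) in wM *.
  have Dz : D (proj k a' z) by apply: slice_in => //; exact: sub.
  have cg : {for z, continuous (g \o proj k a')}.
    apply: (sephol_continuous (D := proj k a' @^-1` D)) => //.
    + exact: open_proj.
    + exact: sephol_proj.
    + exact: locbdd_proj Pk Dz.
  have cn : {for z, continuous (fun z => normc (g (proj k a' z)))}.
    exact: (cvg_comp _ (@normc R) cg (@normc_continuous R _)).
  have : nbhs z [set z' | M%:R < normc (g (proj k a' z'))].
    exact: (cn _ (lt_nbhsr wM)).
  move=> /nbhs_boxP[e e0 eM]; exists (e / 2); first by rewrite divr_gt0.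
  move=> z' zz' /(_ w wr); rewrite leNgt => /negP; apply.
  by apply: eM; apply: cbox_box zz'; lra.
- have Hh : holon (disc r) (fun w => g (setc (proj k a z) j (a 0 j + w))).
    have := holon_shift (a 0 j) (sg (proj k a z) j).
    apply: holonS => w wr /=; rewrite setc_proj; apply: slice_in => //; exact: sub.
  have d0 : disc r !=set0 by exists 0; rewrite /disc /mkset normc0 ltW.
  have [w _ Hw] := max_normc d0 (@compact_disc R r) (fun w wr => holon_continuous Hh wr).
  set m := normc _ in Hw.
  exists (Num.truncn m).+1 => w' wr'; rewrite -setc_proj.
  by apply: le_trans (Hw w' wr') _; apply: ltW; exact: truncnS_gt.
- by exists M%:R, c, e; split => // z w /cE; exact.
Qed.

(** Each step applies [hartogs_extension] to the variables [t] and [j]: the radius in the variable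
    [t] grows from [ep] to [r / 16], whatever the size of [ep], while the square in the variable [j]
    is halved. *)
Lemma bounded_extend M c e : 0 < e -> cbox c e `<=` cbox a (r / 32) ->
  (forall z w, cbox c e z -> normc w <= r ->
     normc (g (proj k (setc a j (a 0 j + w)) z)) <= M) ->
  forall t, (t <= k)%N -> exists ep s M', [/\ 0 < ep, ep <= r / 2, 0 < s, s <= r / 2 &
    forall z w, (forall i : 'I_n, (i < t)%N -> normc (z 0 i - c 0 i) <= r / 2 / 8) ->
      (forall i : 'I_n, (t <= i < k)%N -> normc (z 0 i - c 0 i) <= ep) ->
      square s w ->
      normc (g (proj k (setc a j (a 0 j + w)) z)) <= M'].
Proof.
move=> e0 ce gM.
have r20 : 0 < r / 2 by rewrite divr_gt0.
have ca : cbox a (r / 32) c by apply: ce; apply: cbox_center; exact: ltW.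
have sqr (s : R) (w : C) : s <= r / 2 -> square s w -> normc w <= r.
  move=> sr [w1 w2]; apply: le_trans (normc_le_ReIm w) _.
  by rewrite [leRHS]splitr; apply: lerD; [apply: le_trans w1 sr|apply: le_trans w2 sr].
have inD z w : (forall i : 'I_n, (i < k)%N -> normc (z 0 i - c 0 i) <= r / 2) ->
    normc w <= r -> D (proj k (setc a j (a 0 j + w)) z).
  move=> zc wr; apply: slice_in => // i ik.
  have := le_normcD (z 0 i - c 0 i) (c 0 i - a 0 i).
  rewrite addrA subrK => /le_trans; apply.
  apply: (@le_trans _ _ (r / 2 + r / 32)); last by lra.
  by apply: lerD; [exact: zc|exact: ca].
elim=> [|t IH] tk.
  exists (Num.min e (r / 2)), (r / 2), M; split => //.
  - by rewrite lt_min e0.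
  - by rewrite ge_min lexx orbT.
  (* Coordinates from [k] on do not affect the value; they are reset to those of [c] so that the
     point lies in [cbox c e]. *)
  - move=> z w _ zc ws; pose z' := proj k c z.
    have -> : proj k (setc a j (a 0 j + w)) z = proj k (setc a j (a 0 j + w)) z'.
      by apply/rowP => i; rewrite !projE; case: ifP.
    apply: gM; last exact: sqr ws.
    move=> i; rewrite projE; case: ifP => ik; last by rewrite subrr normc0 ltW.
    by apply: le_trans (zc i _) _; [rewrite ik|rewrite ge_min lexx].
have {IH} [ep [s [M' [ep0 epr s0 sr H]]]] := IH (ltnW tk).
have tn : (t < n)%N by exact: ltn_trans tk kn.
pose jt := Ordinal tn.
have jtE (i : 'I_n) : (i == jt) = (i == t :> nat) by [].
(* The other variables among the first [k] form the parameter; the coordinate [t] of [x] is free and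
   is overwritten by [setc]. *)
pose X := {x : V | (forall i : 'I_n, (i < t)%N -> normc (x 0 i - c 0 i) <= r / 2 / 8) /\
  (forall i : 'I_n, (t < i < k)%N -> normc (x 0 i - c 0 i) <= ep)}.
pose f (x : X) (u w : C) :=
  g (proj k (setc a j (a 0 j + w)) (setc (sval x) jt (c 0 jt + u))).
have xin (x : X) u : disc (r / 2) u ->
    forall i : 'I_n, (i < k)%N -> normc (setc (sval x) jt (c 0 jt + u) 0 i - c 0 i) <= r / 2.
  case: x => x [x1 x2] /= ur i ik; rewrite setcE jtE.
  case: ltngtP => [it|ti|it].
  - by apply: le_trans (x1 i it) _; lra.
  - by apply: le_trans (x2 i _) epr; rewrite ti ik.
  - have -> : i = jt by apply: val_inj.
    by rewrite addrC addKr.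
have [||||M'' HM''] := @hartogs_extension R X f ep (r / 2) s M' ep0 epr s0.
- move=> x w ws.
  have := holon_shift (c 0 jt) (sg (proj k (setc a j (a 0 j + w)) (sval x)) jt).
  have E u : setc (proj k (setc a j (a 0 j + w)) (sval x)) jt u =
      proj k (setc a j (a 0 j + w)) (setc (sval x) jt u) by rewrite proj_setc /= tk.
  move=> Hh; apply: (@eq_holon _ _ (fun u => g (setc (proj k (setc a j (a 0 j + w)) (sval x)) jt (c 0 jt + u)))).
    by move=> u; rewrite /f E.
  apply: holonS Hh => u ur /=; rewrite E; apply: inD; first exact: xin.
  exact: sqr ws.
- move=> x u ue; set z := setc (sval x) jt (c 0 jt + u).
  have := holon_shift (a 0 j) (sg (proj k a z) j) => Hh.
  apply: (@eq_holon _ _ (fun w => g (setc (proj k a z) j (a 0 j + w)))).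
    by move=> w; rewrite /f setc_proj.
  apply: holonS Hh => w ws /=; rewrite setc_proj; apply: inD; last exact: sqr ws.
  by apply: xin; apply: le_trans epr.
- move=> x u w ue ws; apply: H => //.
    move=> i it; rewrite setcE jtE ltn_eqF //.
    by case: (x) => y [y1 y2] /=; exact: y1.
  move=> i /andP[ti ik]; rewrite setcE jtE; case: eqP => [it|/eqP it].
    by have -> : i = jt by [apply: val_inj]; rewrite addrC addKr.
  by case: (x) => y [y1 y2] /=; apply: y2; rewrite ik andbT ltn_neqAle eq_sym it.
(* For fixed [w] only [k] variables remain, so the induction hypothesis and compactness bound [g] on
   the box of radius [r / 2]. *)
- move=> w ws; set a' := setc a j (a 0 j + w).
  have wr : normc w <= r by exact: sqr ws.
  have cD : cbox c (r / 2) `<=` proj k a' @^-1` D.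
    by move=> z zc; apply: inD => // i _; exact: zc.
  have oP : open (proj k a' @^-1` D) by exact: open_proj.
  have sP : sephol (proj k a' @^-1` D) (g \o proj k a') by exact: sephol_proj.
  have [|M0 HM0] := sephol_bounded oP sP (ltW r20) cD.
    by move=> z /cD; exact: locbdd_proj.
  exists M0 => x u ur; pose z' := proj k c (setc (sval x) jt (c 0 jt + u)).
  have -> : f x u w = (g \o proj k a') z'.
    rewrite /f /=; congr (g _); apply/rowP => i; rewrite !projE; by case: ifP.
  apply: HM0 => i; rewrite projE; case: ifP => ik; last by rewrite subrr normc0 ltW.
  exact: xin.
- exists ep, (s / 2), M''; split => //; [by rewrite divr_gt0|by lra|].
  move=> z w z1 z2 ws.
  have xP : (forall i : 'I_n, (i < t)%N -> normc (z 0 i - c 0 i) <= r / 2 / 8) /\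
      (forall i : 'I_n, (t < i < k)%N -> normc (z 0 i - c 0 i) <= ep).
    by split=> // i it; apply: z1; exact: ltnW.
  have := HM'' (exist _ z xP) (z 0 jt - c 0 jt) w (z1 jt (leqnn _)) ws.
  by rewrite /f /= [c 0 jt + _]addrC subrK setc_id.
Qed.

(** The box found by Baire's argument is centred at [c], not at [a]. As [c] is within [r / 32] of
    [a], the extended radius [r / 16] about [c] still covers a box of radius [r / 32] about [a] in
    the first [k] variables. *)
Lemma locbdd_step : locbdd (g \o proj k.+1 a) a.
Proof.
have [M [c [e [e0 ce gM]]]] := bounded_start.
have [ep [s [M' [_ _ s0 _ H]]]] := bounded_extend e0 ce gM (leqnn k).
have ca : cbox a (r / 32) c by apply: ce; apply: cbox_center; exact: ltW.
exists (Num.min s (r / 32)), M'; split; first by rewrite lt_min s0 divr_gt0.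
move=> z az.
have -> : (g \o proj k.+1 a) z = g (proj k (setc a j (a 0 j + (z 0 j - a 0 j))) z).
  rewrite /=; congr (g _); apply/rowP => i; rewrite !(projE, setcE) jk ltnS leq_eqVlt.
  case: eqP => [ij|_] //=; have -> : i = j by apply: val_inj.
  by rewrite ltnn addrC subrK.
apply: H.
- move=> i ik; have := le_normcD (z 0 i - a 0 i) (a 0 i - c 0 i).
  rewrite addrA subrK => /le_trans; apply.
  apply: (@le_trans _ _ (r / 32 + r / 32)); last by lra.
  apply: lerD; first by apply: le_trans (az i) _; rewrite ge_min lexx orbT.
  by rewrite normcB; exact: ca.
- by move=> i /andP[ki]; rewrite ltnNge ki.
- have az' : normc (z 0 j - a 0 j) <= s.
    by apply: le_trans (az j) _; rewrite ge_min lexx.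
  by split; apply: le_trans az'; [exact: normc_Re|exact: normc_Im].
Qed.

End Step.

Theorem hartogs_locbdd D g a : open D -> sephol D g -> D a -> locbdd g a.
Proof.
move=> oD sg; have P k : (k <= n)%N -> forall b, D b -> locbdd (g \o proj k b) b.
  elim: k => [_ b Db|k IH kn b Db].
    exists 1, (normc (g b)); split => // z _ /=.
    suff -> : proj 0 b z = b by [].
    by apply/rowP => i; rewrite projE.
  have [r r0 rD] := open_cbox oD Db.
  have h := locbdd_step kn oD sg (IH (ltnW kn)) r0 rD; exact: h.
move=> Da; have [r [M [r0 H]]] := P n (leqnn n) a Da.
exists r, M; split => // z /H /=.
suff -> : proj n a z = z by [].
by apply/rowP => i; rewrite projE ltn_ord.
Qed.

End Induction.

(** * The Cauchy-Riemann equations *)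

Section CauchyRiemann.
Variable R : realType.
Notation C := R[i].

Lemma MVT01 (phi dphi : R -> R) :
  (forall t : R, 0 <= t <= 1 -> is_derive t 1 phi (dphi t)) ->
  exists2 t, 0 <= t <= 1 & phi 1 - phi 0 = dphi t.
Proof.
move=> H; have [t t01 tE] : exists2 c, c \in `[0, 1] & phi 1 - phi 0 = dphi c * (1 - 0).
  apply: MVT_segment => // [t|].
    by move=> /subset_itv_oo_cc; rewrite in_itv; exact: H.
  apply: continuous_within => t; rewrite /= in_itv => t01.
  apply/differentiable_continuous/derivable1_diffP.
  by have [] := H t t01.
by exists t; [rewrite in_itv in t01|rewrite tE subr0 mulr1].
Qed.

(** From [z] to [w] by a horizontal and then a vertical segment: the mean value theorem on each one
    leaves partial derivatives at points near [z], where they are close to those at [z]. *)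
Lemma differentiable_partials (U : C -> R) (P Q : C -> R) (z : C) (d0 : R) : 0 < d0 ->
  (forall w, normc (w - z) < d0 ->
     is_derive (0 : R) 1 (fun h : R => U (w + h%:C)) (P w) /\
     is_derive (0 : R) 1 (fun h : R => U (w + 0 +i* h)) (Q w)) ->
  {for z, continuous P} -> {for z, continuous Q} ->
  forall e : R, 0 < e -> exists2 d : R, 0 < d & forall w, normc (w - z) < d ->
    `|U w - U z - (P z * complex.Re (w - z) + Q z * complex.Im (w - z))| <= e * normc (w - z).
Proof.
move=> d00 H cP cQ e e0; have e20 : 0 < e / 2 by rewrite divr_gt0.
have nearP : exists2 d : R, 0 < d & forall w, normc (w - z) < d -> `|P w - P z| < e / 2.
  move/cvgrPdist_lt : cP => /(_ _ e20) /nbhsCP[d d1 Hd]; exists d => // w /Hd.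
  by rewrite distrC.
have nearQ : exists2 d : R, 0 < d & forall w, normc (w - z) < d -> `|Q w - Q z| < e / 2.
  move/cvgrPdist_lt : cQ => /(_ _ e20) /nbhsCP[d d1 Hd]; exists d => // w /Hd.
  by rewrite distrC.
have [d1 d10 HP] := nearP; have [d2 d20 HQ] := nearQ.
pose d := Num.min d0 (Num.min d1 d2).
have d_gt0 : 0 < d by rewrite !lt_min d00 d10.
(* The modulus of any point of the two segments, relative to [z], is estimated by the sum of its
   coordinates, at most twice that of [h]. *)
exists (d / 2); first by rewrite divr_gt0.
move=> w wd; set h := w - z in wd *.
pose h1 := complex.Re h; pose h2 := complex.Im h.
have lt_d (a b : R) : `|a| <= `|h1| -> `|b| <= `|h2| -> normc (a +i* b) < d.
  move=> ah bh; apply: le_lt_trans (normc_le_ReIm _) _ => /=.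
  apply: (@le_lt_trans _ _ (normc h + normc h)); last by move: wd; lra.
  apply: lerD; first by apply: le_trans ah _; exact: normc_Re.
  by apply: le_trans bh _; exact: normc_Im.
have sc (t x : R) : 0 <= t <= 1 -> `|t * x| <= `|x|.
  by move=> /andP[t0 t1]; rewrite normrM ger0_norm // ler_piMl.
have aff (t x : R) : is_derive t 1 (fun s : R => (s - t) * x) x.
  by apply: is_derive_eq; rewrite /GRing.scale /=; ring.
have [|t t01 E1] := @MVT01 (fun t => U (z + (t * h1)%:C)) (fun t => P (z + (t * h1)%:C) * h1).
  move=> t t01; have [|dU _] := H (z + (t * h1)%:C).
    rewrite addrC addKr; apply: lt_le_trans (lt_d _ 0 (sc t h1 t01) _) _; first by rewrite normr0.
    by rewrite ge_min lexx.
  have dU' : is_derive ((t - t) * h1) 1 (fun h : R => U (z + (t * h1)%:C + h%:C)) (P (z + (t * h1)%:C)).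
    by rewrite subrr mul0r.
  have := is_derive1_comp (g := fun u : R => (u - t) * h1) dU' (aff t h1).
  rewrite /comp; congr (is_derive _ _ _ _); apply/funext => s.
  by congr U; rewrite -addrA -rmorphD -mulrDl [t + _]addrC subrK.
have [|s s01 E2] := @MVT01 (fun t => U (z + h1 +i* (t * h2))) (fun t => Q (z + h1 +i* (t * h2)) * h2).
  move=> s s01; have [|_ dU] := H (z + h1 +i* (s * h2)).
    rewrite addrC addKr; apply: lt_le_trans (lt_d h1 _ _ (sc s h2 s01)) _ => //.
    by rewrite ge_min lexx.
  have dU' : is_derive ((s - s) * h2) 1 (fun h : R => U (z + h1 +i* (s * h2) + 0 +i* h)) (Q (z + h1 +i* (s * h2))).
    by rewrite subrr mul0r.
  have := is_derive1_comp (g := fun u : R => (u - s) * h2) dU' (aff s h2).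
  rewrite /comp; congr (is_derive _ _ _ _); apply/funext => u.
  congr U; rewrite -addrA; congr (_ + _); apply: complex_ext => /=; ring.
have tP : `|P (z + (t * h1)%:C) - P z| < e / 2.
  apply: HP; rewrite addrC addKr; apply: lt_le_trans (lt_d _ 0 (sc t h1 t01) _) _; first by rewrite normr0.
  by rewrite !ge_min lexx orbT.
have tQ : `|Q (z + h1 +i* (s * h2)) - Q z| < e / 2.
  apply: HQ; rewrite addrC addKr; apply: lt_le_trans (lt_d h1 _ _ (sc s h2 s01)) _ => //.
  by rewrite !ge_min lexx !orbT.
have -> : U w - U z - (P z * h1 + Q z * h2) =
    (P (z + (t * h1)%:C) - P z) * h1 + (Q (z + h1 +i* (s * h2)) - Q z) * h2.
  rewrite !mulrBl -E1 -E2 mul0r mul1r.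
  have -> : z + h1 +i* (1 * h2) = w.
    rewrite mul1r; have -> : h1 +i* h2 = h by rewrite /h1 /h2; case: (h).
    by rewrite /h addrC subrK.
  have -> : z + 0%:C = z by rewrite addr0.
  have -> : z + h1 +i* (0 * h2) = z + h1%:C by rewrite mul0r.
  ring.
apply: le_trans (ler_normD _ _) _; rewrite !normrM [e in leRHS]splitr mulrDl.
apply: lerD; apply: ler_pM; rewrite ?normr_ge0 //.
- exact: ltW.
- exact: normc_Re.
- exact: ltW.
- exact: normc_Im.
Qed.

(** Both coordinates are totally differentiable at [z], and their differentials combine into
    multiplication by [l z]. *)
Lemma cauchy_riemann (H l : C -> C) (z : C) (d0 : R) : 0 < d0 ->
  (forall w, normc (w - z) < d0 ->
    [/\ is_derive (0 : R) 1 (fun h : R => complex.Re (H (w + h%:C))) (complex.Re (l w)),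
        is_derive (0 : R) 1 (fun h : R => complex.Im (H (w + h%:C))) (complex.Im (l w)),
        is_derive (0 : R) 1 (fun h : R => complex.Re (H (w + 0 +i* h))) (- complex.Im (l w)) &
        is_derive (0 : R) 1 (fun h : R => complex.Im (H (w + 0 +i* h))) (complex.Re (l w))]) ->
  {for z, continuous l} -> is_derive z 1 H (l z).
Proof.
move=> d00 HH cl.
have cRe : {for z, continuous (fun w => complex.Re (l w))}.
  exact: (cvg_comp _ (@complex.Re R) cl (@Re_continuous R _)).
have cIm : {for z, continuous (fun w => complex.Im (l w))}.
  exact: (cvg_comp _ (@complex.Im R) cl (@Im_continuous R _)).
have cNIm : {for z, continuous (fun w => - complex.Im (l w))}.
  exact: (@continuousN _ _ _ (fun w => complex.Im (l w)) z cIm).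
apply/is_deriveCP => e e0; have e20 : 0 < e / 2 by rewrite divr_gt0.
have [|d1 d10 H1] := @differentiable_partials (fun w => complex.Re (H w))
    (fun w => complex.Re (l w)) (fun w => - complex.Im (l w)) z d0 d00 _ cRe cNIm _ e20.
  by move=> w /HH[].
have [|d2 d20 H2] := @differentiable_partials (fun w => complex.Im (H w))
    (fun w => complex.Im (l w)) (fun w => complex.Re (l w)) z d0 d00 _ cIm cRe _ e20.
  by move=> w /HH[].
exists (Num.min d1 d2); first by rewrite lt_min d10.
move=> w; rewrite lt_min => /andP[/H1 w1 /H2 w2].
apply: le_trans (normc_le_ReIm _) _; rewrite [e]splitr mulrDl; apply: lerD.
  apply: le_trans w1; rewrite le_eqVlt; apply/orP; left; apply/eqP; congr `| _ |.
  move: (H w) (H z) (l z) (w - z) => [a b] [a' b'] [p q] [x y] /=; ring.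
apply: le_trans w2; rewrite le_eqVlt; apply/orP; left; apply/eqP; congr `| _ |.
move: (H w) (H z) (l z) (w - z) => [a b] [a' b'] [p q] [x y] /=; ring.
Qed.

End CauchyRiemann.

Lemma within_open_continuous (T U : topologicalType) (A : set T) (f : T -> U) (x : T) :
  open A -> {within A, continuous f} -> A x -> {for x, continuous f}.
Proof.
by move=> oA; rewrite continuous_open_subspace // => cf Ax; apply: cf; apply/mem_set.
Qed.

(** * Octonion-valued functions *)

Section Coordinates.
Variable R : realType.
Notation C := R[i].

Definition sel (T : Type) (b : bool) (x : T * T) : T := if b then x.2 else x.1.

Definition coord (b : bool * bool * bool) (x : octonion R) : R :=
  sel b.2 (sel b.1.2 (sel b.1.1 x)).

Lemma coord_ext (x y : octonion R) : (forall b, coord b x = coord b y) -> x = y.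
Proof.
case: x y => [[[x0 x1] [x2 x3]] [[x4 x5] [x6 x7]]] [[[y0 y1] [y2 y3]] [[y4 y5] [y6 y7]]] H.
have := H (false, false, false); have := H (false, false, true).
have := H (false, true, false); have := H (false, true, true).
have := H (true, false, false); have := H (true, false, true).
have := H (true, true, false); have := H (true, true, true).
by rewrite /coord /sel /= => -> -> -> -> -> -> -> ->.
Qed.

Definition octonion_of (c : bool * bool * bool -> R) : octonion R :=
  (((c (false, false, false), c (false, false, true)), (c (false, true, false), c (false, true, true))),
   ((c (true, false, false), c (true, false, true)), (c (true, true, false), c (true, true, true)))).

Lemma coordK c b : coord b (octonion_of c) = c b.
Proof. by case: b => [[[] []] []]. Qed.

Lemma coordD b x y : coord b (x + y) = coord b x + coord b y.
Proof. by case: b => [[[] []] []]. Qed.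

Lemma coordN b x : coord b (- x) = - coord b x.
Proof. by case: b => [[[] []] []]. Qed.

Lemma is_derive_pair (U W : normedModType R) (phi : R -> U * W) (x : R) l1 l2 :
  is_derive x 1 (fun t => (phi t).1) l1 -> is_derive x 1 (fun t => (phi t).2) l2 ->
  is_derive x 1 phi (l1, l2).
Proof.
move=> [d1 e1] [d2 e2].
have c : h^-1 *: ((phi \o shift x) (h *: 1) - phi x) @[h --> (0 : R)^'] --> (l1, l2).
  rewrite (_ : (fun h => _) = (fun h : R => (h^-1 *: ((phi (h *: 1 + x)).1 - (phi x).1),
     h^-1 *: ((phi (h *: 1 + x)).2 - (phi x).2)))).
    by apply: cvg_pair; [rewrite -e1; exact: d1|rewrite -e2; exact: d2].
  apply/funext => h /=; rewrite [LHS]surjective_pairing.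
  by [].
by apply: DeriveDef; [apply/cvg_ex; exists (l1, l2); exact: c|apply/cvg_lim => //; exact: c].
Qed.

Lemma is_derive_fst (U W : normedModType R) (phi : R -> U * W) (x : R) l :
  is_derive x 1 phi l -> is_derive x 1 (fun t => (phi t).1) l.1.
Proof.
move=> [d e].
have c : h^-1 *: ((phi \o shift x) (h *: 1) - phi x) @[h --> (0 : R)^'] --> l.
  by rewrite -e; exact: d.
have c1 : h^-1 *: ((phi (h *: 1 + x)).1 - (phi x).1) @[h --> (0 : R)^'] --> l.1.
  exact: (cvg_comp _ (@fst U W) c cvg_fst).
by apply: DeriveDef; [apply/cvg_ex; exists l.1; exact: c1|apply/cvg_lim => //; exact: c1].
Qed.

Lemma is_derive_snd (U W : normedModType R) (phi : R -> U * W) (x : R) l :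
  is_derive x 1 phi l -> is_derive x 1 (fun t => (phi t).2) l.2.
Proof.
move=> [d e].
have c : h^-1 *: ((phi \o shift x) (h *: 1) - phi x) @[h --> (0 : R)^'] --> l.
  by rewrite -e; exact: d.
have c2 : h^-1 *: ((phi (h *: 1 + x)).2 - (phi x).2) @[h --> (0 : R)^'] --> l.2.
  exact: (cvg_comp _ (@snd U W) c cvg_snd).
by apply: DeriveDef; [apply/cvg_ex; exists l.2; exact: c2|apply/cvg_lim => //; exact: c2].
Qed.

Lemma is_derive_coord b (phi : R -> octonion R) (x : R) (l : octonion R) :
  is_derive x 1 phi l -> is_derive x 1 (fun t => coord b (phi t)) (coord b l).
Proof.
move=> d; have d1 := is_derive_fst d; have d2 := is_derive_snd d.
have d11 := is_derive_fst d1; have d12 := is_derive_snd d1.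
have d21 := is_derive_fst d2; have d22 := is_derive_snd d2.
case: b => [[[] []] []]; rewrite /coord /sel /=.
- exact: (is_derive_snd d22).
- exact: (is_derive_fst d22).
- exact: (is_derive_snd d21).
- exact: (is_derive_fst d21).
- exact: (is_derive_snd d12).
- exact: (is_derive_fst d12).
- exact: (is_derive_snd d11).
- exact: (is_derive_fst d11).
Qed.

Lemma is_derive_octonion (phi : R -> octonion R) (x : R) (c : bool * bool * bool -> R) :
  (forall b, is_derive x 1 (fun t => coord b (phi t)) (c b)) ->
  is_derive x 1 phi (octonion_of c).
Proof.
by move=> H; do !apply: is_derive_pair;
  [exact: (H (false, false, false))|exact: (H (false, false, true))
  |exact: (H (false, true, false))|exact: (H (false, true, true))
  |exact: (H (true, false, false))|exact: (H (true, false, true))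
  |exact: (H (true, true, false))|exact: (H (true, true, true))].
Qed.

Lemma continuous_pair (T U W : topologicalType) (f : T -> U * W) (x : T) :
  {for x, continuous (fun t => (f t).1)} -> {for x, continuous (fun t => (f t).2)} ->
  {for x, continuous f}.
Proof.
move=> c1 c2; have c := cvg_pair c1 c2; rewrite /prop_for /continuous_at.
rewrite (surjective_pairing (f x)).
suff -> : f = (fun t => ((f t).1, (f t).2)) by exact: c.
by apply/funext => t; exact: surjective_pairing.
Qed.

Lemma continuous_octonion (T : topologicalType) (f : T -> octonion R) (x : T) :
  (forall b, {for x, continuous (fun t => coord b (f t))}) -> {for x, continuous f}.
Proof.
by move=> H; do !apply: continuous_pair;
  [exact: (H (false, false, false))|exact: (H (false, false, true))
  |exact: (H (false, true, false))|exact: (H (false, true, true))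
  |exact: (H (true, false, false))|exact: (H (true, false, true))
  |exact: (H (true, true, false))|exact: (H (true, true, true))].
Qed.

Lemma continuous_fst (T U W : topologicalType) (f : T -> U * W) (x : T) :
  {for x, continuous f} -> {for x, continuous (fun t => (f t).1)}.
Proof. by move=> c; exact: (cvg_comp f (@fst U W) c cvg_fst). Qed.

Lemma continuous_snd (T U W : topologicalType) (f : T -> U * W) (x : T) :
  {for x, continuous f} -> {for x, continuous (fun t => (f t).2)}.
Proof. by move=> c; exact: (cvg_comp f (@snd U W) c cvg_snd). Qed.

Lemma continuous_coord (T : topologicalType) b (f : T -> octonion R) (x : T) :
  {for x, continuous f} -> {for x, continuous (fun t => coord b (f t))}.
Proof.
move=> d; have d1 := continuous_fst d; have d2 := continuous_snd d.
have d11 := continuous_fst d1; have d12 := continuous_snd d1.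
have d21 := continuous_fst d2; have d22 := continuous_snd d2.
case: b => [[[] []] []]; rewrite /coord /sel /=.
- exact: (continuous_snd d22).
- exact: (continuous_fst d22).
- exact: (continuous_snd d21).
- exact: (continuous_fst d21).
- exact: (continuous_snd d12).
- exact: (continuous_fst d12).
- exact: (continuous_snd d11).
- exact: (continuous_fst d11).
Qed.

(** These eight functions identify the complexified octonions with the eighth power of C, left
    multiplication by [oc_i] becoming multiplication by i; holomorphy can thus be tested on each of
    them. *)
Definition ccoord b (p : octC R) : C := coord b p.1 +i* coord b p.2.

Definition cst1 (w : C) : 'rV[C]_1 := \row_(_ < 1) w.

Lemma cst1_add w u : cst1 w + u *: delta_mx 0 (0 : 'I_1) = cst1 (w + u).
Proof. by apply/rowP => k; rewrite !mxE (ord1 k) eqxx mulr1. Qed.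

Lemma continuous_cst1 : continuous cst1.
Proof.
move=> w A /nbhs_boxP[r r0 rA]; apply/nbhsCP; exists r => // u uw; apply: rA => k.
by rewrite !mxE.
Qed.

Lemma ocmul_i (q : octC R) : ocmul (oc_i R) q = (- q.2, q.1).
Proof.
case: q => [[[[? ?] [? ?]] [[? ?] [? ?]]] [[[? ?] [? ?]] [[? ?] [? ?]]]].
rewrite /ocmul /oc_i /omul /cd_mul /cd_conj /oone /=.
by do ![congr pair]; rewrite /=; ring.
Qed.

Lemma dbar_eq0 (A B : octC R) :
  2^-1 *: (A + ocmul (oc_i R) B) = 0 -> A.1 = B.2 /\ A.2 = - B.1.
Proof.
rewrite ocmul_i => /eqP; rewrite scaler_eq0 invr_eq0 pnatr_eq0 /= => /eqP.
move=> E; have E1 : A.1 - B.2 = 0 by exact: (congr1 fst E).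
have E2 : A.2 + B.1 = 0 by exact: (congr1 snd E).
by split; [apply/eqP; rewrite -subr_eq0 E1|apply/eqP; rewrite -addr_eq0 E2].
Qed.

Lemma holon_ccoord (D : set 'rV[C]_1) (G : 'rV[C]_1 -> octC R) b :
  open D -> C1_on D G -> holomorphic_on D G ->
  holon [set w | D (cst1 w)] (fun w => ccoord b (G (cst1 w))).
Proof.
move=> oD GC1 Gh; exists (fun w => ccoord b (d_alpha G 0 (cst1 w))) => w Dw.
have [dA dB cA cB] := GC1 0.
have cc : {for w, continuous (fun w => ccoord b (d_alpha G 0 (cst1 w)))}.
  have c1 : {for cst1 w, continuous (d_alpha G 0)}.
    exact: (within_open_continuous oD cA Dw).
  have c2 : {for w, continuous (fun w => d_alpha G 0 (cst1 w))}.
    exact: (cvg_comp cst1 (d_alpha G 0) (@continuous_cst1 w) c1).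
  have c3 := continuous_coord (b := b) (continuous_fst c2).
  have c4 := continuous_coord (b := b) (continuous_snd c2).
  exact: (cvg_complex c3 c4).
split; last exact: cc.
have : nbhs w [set w | D (cst1 w)].
  by apply: (@continuous_cst1 w); exact: open_nbhs_nbhs (conj oD Dw).
move=> /nbhsCP[d0 d00 Hd0].
apply: (cauchy_riemann d00) cc => u /Hd0 Du.
have [E1 E2] := dbar_eq0 (Gh 0 _ Du).
have dA' : is_derive (0 : R) 1 (fun h : R => G (cst1 (u + h%:C))) (d_alpha G 0 (cst1 u)).
  rewrite (_ : (fun h : R => _) = along G 1 0 (cst1 u)).
    by apply: DeriveDef; [exact: dA|rewrite /d_alpha derive1E].
  by apply/funext => h; rewrite /along mulr1 cst1_add.
have dB' : is_derive (0 : R) 1 (fun h : R => G (cst1 (u + 0 +i* h))) (d_beta G 0 (cst1 u)).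
  rewrite (_ : (fun h : R => _) = along G (0 +i* 1) 0 (cst1 u)).
    by apply: DeriveDef; [exact: dB|rewrite /d_beta derive1E].
  apply/funext => h; rewrite /along cst1_add; congr (G (cst1 (u + _))).
  by apply: complex_ext => /=; ring.
split.
- exact: (is_derive_coord b (is_derive_fst dA')).
- exact: (is_derive_coord b (is_derive_snd dA')).
- rewrite /= E2 coordN opprK; exact: (is_derive_coord b (is_derive_fst dB')).
- rewrite /= E1; exact: (is_derive_coord b (is_derive_snd dB')).
Qed.

(** Slice regularity only provides some holomorphic stem function with the same lift; this
    identifies it with the given one. The imaginary units [e1] and [- e1] separate the two
    components, and left multiplication by [e1] is injective since its square is [-1]. *)
Lemma slice_liftI m (D : set 'rV[C]_m) (F G : 'rV[C]_m -> octC R) :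
  is_stem D F -> is_stem D G ->
  {in Omega D, slice_lift D F =1 slice_lift D G} -> forall z, D z -> F z = G z.
Proof.
move=> sF sG E z Dz.
pose e1 : octonion R := (((0, 1), (0, 0)), ((0, 0), (0, 0))).
have s1 : osphere e1.
  rewrite /osphere /= /omul /cd_mul /cd_conj /oone /e1 /=.
  by do ![congr pair]; rewrite /=; ring.
have s2 : osphere (- e1) by rewrite /osphere /= omulNN.
have omulNl y : omul (- e1) y = - omul e1 y.
  case: y => [[[? ?] [? ?]] [[? ?] [? ?]]].
  by rewrite /omul /cd_mul /cd_conj /e1 /=; do ![congr pair]; rewrite /=; ring.
have e1E p1 p2 q1 q2 r1 r2 t1 t2 :
    omul e1 (((p1, p2), (q1, q2)), ((r1, r2), (t1, t2))) =
    (((- p2, p1), (- q2, q1)), ((- r2, r1), (t2, - t1))).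
  by rewrite /omul /cd_mul /cd_conj /e1 /=; do ![congr pair]; rewrite /=; ring.
have e1K y : omul e1 (omul e1 y) = - y.
  by case: y => [[[? ?] [? ?]] [[? ?] [? ?]]]; rewrite !e1E.
have eq J : osphere J -> (F z).1 + omul J (F z).2 = (G z).1 + omul J (G z).2.
  move=> sJ; rewrite -(slice_liftE sF sJ Dz) -(slice_liftE sG sJ Dz); apply: E; apply/mem_set.
  by exists J, z.
have A := eq _ s1; have := eq _ s2; rewrite !omulNl => B.
have x1 : (F z).1 = (G z).1.
  apply: coord_ext => b; have := congr1 (coord b) A; have := congr1 (coord b) B.
  by rewrite !coordD !coordN; lra.
have x2 : omul e1 (F z).2 = omul e1 (G z).2 by move: A; rewrite x1 => /addrI.
have x3 : (F z).2 = (G z).2.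
  by apply: oppr_inj; rewrite -!e1K x2.
by rewrite [LHS]surjective_pairing [RHS]surjective_pairing x1 x3.
Qed.

End Coordinates.

(** * From complex coordinates back to stem functions *)

Section Main.
Variables (R : realType) (n : nat).
Notation C := R[i].
Notation V := 'rV[R[i]]_n.

Lemma subst_ptE (a : V) j (w : C) : subst_pt a j (cst1 w) = setc a j w.
Proof. by apply/rowP => k; rewrite !mxE. Qed.

Lemma open_restr_dom (D : set V) j a : open D -> open (restr_dom D j a).
Proof.
rewrite !openE => oD w Dw; have /nbhs_boxP[r r0 rD] := oD _ Dw.
apply/nbhs_boxP; exists r => // u uw; apply: rD => k; rewrite !mxE.
by case: eqP => _; [exact: uw|rewrite subrr normc0].
Qed.

Lemma sephol_ccoord (D : set V) (F : V -> octC R) b : open D ->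
  (forall (a : V) (j : 'I_n),
     is_stem (restr_dom D j a) (restr_fun F j a) /\
     slice_regular (restr_dom D j a)
       (slice_lift (restr_dom D j a) (restr_fun F j a))) ->
  sephol D (fun z => ccoord b (F z)).
Proof.
move=> oD H a j; have [sF [G [sG G1 Gh GE]]] := H a j.
have oj : open (restr_dom D j a) by exact: open_restr_dom.
have FG := slice_liftI sF sG GE.
have := holon_ccoord b oj G1 Gh.
have E : [set w | restr_dom D j a (cst1 w)] = [set w | D (setc a j w)].
  by apply/seteqP; split=> w; rewrite /restr_dom /= subst_ptE.
rewrite E; apply: eq_holon_near => w Dw.
have : nbhs w [set w | restr_dom D j a (cst1 w)].
  apply: (@continuous_cst1 R w); apply: open_nbhs_nbhs; split; first exact: oj.
  by rewrite /restr_dom /= subst_ptE.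
apply: filterS => u /= Du; rewrite -FG //.
by rewrite /restr_fun subst_ptE.
Qed.

Lemma setc_add (z : V) t (u : C) : z + u *: delta_mx 0 t = setc z t (z 0 t + u).
Proof.
apply/rowP => k; rewrite !mxE eqxx /=; case: eqP => [->|_]; first by rewrite mulr1.
by rewrite mulr0 addr0.
Qed.

(** The derivative in the direction [u] predicted by complex linearity, reassembled from the eight
    complex coordinates. *)
Definition along_deriv (F : V -> octC R) (u : C) (t : 'I_n) (z : V) : octC R :=
  (octonion_of (fun b => complex.Re (pderiv (fun z => ccoord b (F z)) t z * u)),
   octonion_of (fun b => complex.Im (pderiv (fun z => ccoord b (F z)) t z * u))).

Lemma along_is_derive (D : set V) (F : V -> octC R) u t z :
  (forall b, sephol D (fun z => ccoord b (F z))) -> D z ->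
  is_derive (0 : R) 1 (along F u t z) (along_deriv F u t z).
Proof.
case: u => u1 u2 sF Dz.
have d1 : is_derive (0 : R) 1 (fun h : R => complex.Re (z 0 t) + h * u1) u1.
  by apply: is_derive_eq; rewrite /GRing.scale /=; ring.
have d2 : is_derive (0 : R) 1 (fun h : R => complex.Im (z 0 t) + h * u2) u2.
  by apply: is_derive_eq; rewrite /GRing.scale /=; ring.
have z0 : z 0 t = (complex.Re (z 0 t) + 0 * u1) +i* (complex.Im (z 0 t) + 0 * u2).
  by rewrite !mul0r !addr0; case: (z 0 t).
have E (h : R) : along F (u1 +i* u2) t z h =
    F (setc z t ((complex.Re (z 0 t) + h * u1) +i* (complex.Im (z 0 t) + h * u2))).
  rewrite /along setc_add; congr (F (setc z t _)).
  by case: (z 0 t) => a b; apply: complex_ext => /=; ring.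
apply: is_derive_pair; apply: is_derive_octonion => b.
  have := is_derive_path d1 d2 z0 (sephol_pderiv t (sF b) Dz).
  by congr (is_derive _ _ _ _); apply/funext => h; rewrite E.
(* The imaginary part of a function is the real part of its product with -i. *)
have := is_derive_path d1 d2 z0 (is_deriveZ (- 'i) (sephol_pderiv t (sF b) Dz)).
congr (is_derive _ _ _ _).
  by apply/funext => h; rewrite E /GRing.scale /=; ring.
by case: (pderiv _ _ _) => x y; rewrite /GRing.scale /=; ring.
Qed.

(** Hartogs' theorem enters here: [hartogs_locbdd] gives the local boundedness from which the
    complex partial derivatives are continuous. *)
Lemma along_deriv_continuous (D : set V) (F : V -> octC R) u t z : open D ->
  (forall b, sephol D (fun z => ccoord b (F z))) -> D z ->
  {for z, continuous (along_deriv F u t)}.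
Proof.
move=> oD sF Dz.
have c b : {for z, continuous (fun z => pderiv (fun z => ccoord b (F z)) t z * u)}.
  have cp := pderiv_continuous (t := t) oD (sF b) Dz (hartogs_locbdd oD (sF b) Dz).
  by apply: (@continuousM _ _ _ (fun=> u) z cp); exact: cst_continuous.
apply: continuous_pair; apply: continuous_octonion => b.
- have cr := cvg_comp _ (@complex.Re R) (c b) (@Re_continuous R _).
  rewrite (_ : (fun z => _) = (fun z => complex.Re (pderiv (fun z => ccoord b (F z)) t z * u))).
    exact: cr.
  by apply/funext => x; rewrite coordK.
- have cr := cvg_comp _ (@complex.Im R) (c b) (@Im_continuous R _).
  rewrite (_ : (fun z => _) = (fun z => complex.Im (pderiv (fun z => ccoord b (F z)) t z * u))).
    exact: cr.
  by apply/funext => x; rewrite coordK.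
Qed.

End Main.

Theorem theorem6p3 (R : realType) (n : nat) (n_gt0 : (0 < n)%N)
  (D : set 'rV[R[i]]_n) (Dopen : open D) (Dconn : connected D)
  (F : 'rV[R[i]]_n -> octC R) (Fstem : is_stem D F)
  (f : 'rV[octonion R]_n -> octonion R)
  (f_lift : {in Omega D, f =1 slice_lift D F})
  (f_sep : forall (a : 'rV[R[i]]_n) (j : 'I_n),
     is_stem (restr_dom D j a) (restr_fun F j a) /\
     slice_regular (restr_dom D j a)
       (slice_lift (restr_dom D j a) (restr_fun F j a))) :
  slice_regular D f.
Proof.
have sF b := sephol_ccoord b Dopen f_sep.
have dF u t z : D z -> is_derive (0 : R) 1 (along F u t z) (along_deriv F u t z).
  exact: along_is_derive.
have dA t z : D z -> d_alpha F t z = along_deriv F 1 t z.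
  by move=> Dz; rewrite /d_alpha derive1E; have [_ ->] := dF 1 t z Dz.
have dB t z : D z -> d_beta F t z = along_deriv F (0 +i* 1) t z.
  by move=> Dz; rewrite /d_beta derive1E; have [_ ->] := dF (0 +i* 1) t z Dz.
have cF u t : {within D, continuous (along_deriv F u t)}.
  by apply: continuous_within => z Dz; exact: along_deriv_continuous Dopen sF Dz.
exists F; split => //.
  move=> t; split.
  - by move=> z Dz; have [] := dF 1 t z Dz.
  - by move=> z Dz; have [] := dF (0 +i* 1) t z Dz.
  - by apply: subspace_eq_continuous (cF 1 t) => z /set_mem Dz; exact: esym (dA t z Dz).
  - by apply: subspace_eq_continuous (cF (0 +i* 1) t) => z /set_mem Dz; exact: esym (dB t z Dz).
(* In each complex coordinate, with [p] the complex partial derivative, the bracket is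
   [p + i * (p * i) = 0]. *)
move=> t z Dz; rewrite /dbar dA // dB // ocmul_i /along_deriv /=.
apply/eqP; rewrite scaler_eq0; apply/orP; right; apply/eqP.
congr pair; apply: coord_ext => b; rewrite coordD ?coordN !coordK.
  rewrite (_ : coord b 0 = 0); last by case: b => [[[] []] []].
  by case: (pderiv _ _ _) => x y /=; ring.
rewrite (_ : coord b 0 = 0); last by case: b => [[[] []] []].
by case: (pderiv _ _ _) => x y /=; ring.
Qed.
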